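(* Let $0<l<\infty$ and let $\Phi_1(x)$ be an $m_2\times m_1$ matrix function which is boundedly differentiable on the interval $[0,l]$. Let the operator $S\in B\big(L^2_{m_2}(0,l)\big)$ be given by $$(Sf)(x)=\big(I_{m_2}+\Phi_1(0)\Phi_1(0)^*\big)f(x)+\int_0^l s(x,t)f(t)\,dt,$$ $$s(x,t)=\int_0^{\min(x,t)}\Phi_1'(x-\zeta)\Phi_1'(t-\zeta)^*\,d\zeta+\begin{cases}\Phi_1'(x-t)\Phi_1(0)^*, & x>t,\\ \Phi_1(0)\Phi_1'(t-x)^*, & t>x.\end{cases}$$ Then $S$ is strictly positive. Furthermore, the inequality $S\ge I$ holds.
   Context: $m_1,m_2$ are positive integers; $I_{m_2}$ is the $m_2\times m_2$ identity matrix and $I$ is the identity operator; matrices and scalars are complex. $L^2_{m_2}(0,l)$ is the Hilbert space of square-integrable $\mathbb{C}^{m_2}$-valued functions on $(0,l)$, and $B(\mathbf H)$ denotes the bounded linear operators on $\mathbf H$. ''Boundedly differentiable'' means differentiable with bounded derivative. Operator inequalities are in the sense of quadratic forms of self-adjoint operators; ''strictly positive'' means $S\ge\delta I$ for some $\delta>0$. The star denotes conjugate transpose of a matrix. *)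

(* Defs.v *)
(* Scalars are taken in R[i], for an arbitrary R : realType. *)
From HB Require Import structures.
From mathcomp Require Import all_boot all_order all_algebra.
From mathcomp Require Import complex.
From mathcomp Require Import all_classical all_reals all_analysis.
Set Implicit Arguments.
Unset Strict Implicit.
Unset Printing Implicit Defensive.
Import Order.TTheory GRing.Theory Num.Theory.
Import numFieldNormedType.Exports.
Local Open Scope classical_set_scope.
Local Open Scope sesquilinear_scope.
Local Open Scope complex_scope.
Local Open Scope ring_scope.

(* The domain of the increment h is cut down to the h with x + h in D, so the
   derivative is one-sided at an end point of an interval D. *)
Definition has_derivative_within (R : realType) (D : set R) (f : R -> R)
    (x df : R) : Prop :=
  (fun h : R => h^-1 * (f (x + h) - f x))
    @ within [set h | D (x + h)] 0^' --> df.

Definition mx_has_derivative_on (R : realType) (m n : nat) (D : set R)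
    (F dF : R -> 'M[R[i]]_(m, n)) : Prop :=
  forall x, D x -> forall i j,
    has_derivative_within D (fun y => complex.Re (F y i j)) x
      (complex.Re (dF x i j)) /\
    has_derivative_within D (fun y => complex.Im (F y i j)) x
      (complex.Im (dF x i j)).

Definition mx_bounded_on (R : realType) (m n : nat) (D : set R)
    (F : R -> 'M[R[i]]_(m, n)) : Prop :=
  exists M : R, forall x, D x -> forall i j, Normc.normc (F x i j) <= M.

(* F is boundedly differentiable on `[0, l] with derivative dF. The values of
   F and dF outside `[0, l] are unconstrained. *)
Definition boundedly_differentiable (R : realType) (m n : nat) (l : R)
    (F dF : R -> 'M[R[i]]_(m, n)) : Prop :=
  mx_has_derivative_on `[0, l] F dF /\ mx_bounded_on `[0, l] dF.

Definition Cintegral (R : realType) (D : set R) (f : R -> R[i]) : R[i] :=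
  (\int[@lebesgue_measure R]_(x in D) complex.Re (f x)) +i*
  (\int[@lebesgue_measure R]_(x in D) complex.Im (f x)).

Definition mxintegral (R : realType) (m n : nat) (D : set R)
    (F : R -> 'M[R[i]]_(m, n)) : 'M[R[i]]_(m, n) :=
  \matrix_(i, j) Cintegral D (fun x => F x i j).

Definition normsq (R : realType) (m : nat) (v : 'cV[R[i]]_m) : R :=
  \sum_(i < m) Normc.normc (v i 0) ^+ 2.

(* Elements of the Hilbert space L^2_m(0, l) are represented by functions
   satisfying L2, two of which represent the same element when they satisfy
   eqL2; only their values on `]0, l[ matter. *)
Definition L2 (R : realType) (l : R) (m : nat) (f : R -> 'cV[R[i]]_m) : Prop :=
  (forall i, measurable_fun `]0, l[ (fun x => complex.Re (f x i 0)) /\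
             measurable_fun `]0, l[ (fun x => complex.Im (f x i 0))) /\
  (\int[@lebesgue_measure R]_(x in `]0%R, l[) (normsq (f x))%:E < +oo)%E.

Definition eqL2 (R : realType) (l : R) (m : nat) (f g : R -> 'cV[R[i]]_m) :
    Prop :=
  {ae @lebesgue_measure R, forall x, `]0, l[%classic x -> f x = g x}.

Definition dotL2 (R : realType) (l : R) (m : nat) (f g : R -> 'cV[R[i]]_m) :
    R[i] :=
  Cintegral `]0, l[ (fun x => \sum_(i < m) f x i 0 * (g x i 0)^*).

Definition normL2 (R : realType) (l : R) (m : nat) (f : R -> 'cV[R[i]]_m) : R :=
  Num.sqrt (\int[@lebesgue_measure R]_(x in `]0, l[) normsq (f x)).

(* T induces an element of B(L^2_m(0, l)); the second clause says that it is
   well defined on classes of almost everywhere equal functions. *)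
Definition bounded_operator (R : realType) (l : R) (m : nat)
    (T : (R -> 'cV[R[i]]_m) -> (R -> 'cV[R[i]]_m)) : Prop :=
  [/\ forall f, L2 l f -> L2 l (T f),
      forall f g, L2 l f -> L2 l g -> eqL2 l f g -> eqL2 l (T f) (T g),
      forall (a : R[i]) f g, L2 l f -> L2 l g ->
        eqL2 l (T (fun x => a *: f x + g x)) (fun x => a *: T f x + T g x) &
      exists M : R, forall f, L2 l f -> normL2 l (T f) <= M * normL2 l f].

Definition self_adjoint (R : realType) (l : R) (m : nat)
    (T : (R -> 'cV[R[i]]_m) -> (R -> 'cV[R[i]]_m)) : Prop :=
  forall f g, L2 l f -> L2 l g -> dotL2 l (T f) g = dotL2 l f (T g).

(* The last inequality is in R[i], where z <= w also requires z and w to have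
   the same imaginary part. *)
Definition op_le (R : realType) (l : R) (m : nat)
    (A B : (R -> 'cV[R[i]]_m) -> (R -> 'cV[R[i]]_m)) : Prop :=
  [/\ self_adjoint l A, self_adjoint l B &
      forall f, L2 l f -> dotL2 l (A f) f <= dotL2 l (B f) f].

Definition strictly_positive (R : realType) (l : R) (m : nat)
    (T : (R -> 'cV[R[i]]_m) -> (R -> 'cV[R[i]]_m)) : Prop :=
  exists2 delta : R, 0 < delta & op_le l (fun f x => delta%:C *: f x) T.

(* On the diagonal x = t, a null set, the case term is given the value 0. *)
Definition s_kernel (R : realType) (m1 m2 : nat)
    (Phi dPhi : R -> 'M[R[i]]_(m2, m1)) (x t : R) : 'M[R[i]]_m2 :=
  mxintegral `[0, Num.min x t]
    (fun zeta => dPhi (x - zeta) *m (dPhi (t - zeta)) ^t*) +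
  (if t < x then dPhi (x - t) *m (Phi 0) ^t*
   else if x < t then Phi 0 *m (dPhi (t - x)) ^t*
   else 0).

Definition S_op (R : realType) (m1 m2 : nat) (l : R)
    (Phi dPhi : R -> 'M[R[i]]_(m2, m1)) (f : R -> 'cV[R[i]]_m2) (x : R) :
    'cV[R[i]]_m2 :=
  (1%:M + Phi 0 *m (Phi 0) ^t*) *m f x +
  mxintegral `]0, l[ (fun t => s_kernel Phi dPhi x t *m f t).

(* Main.v *)
(* Put [D] for [dPhi1] cut off outside ]0, l[, a bounded measurable function since
   it is a limit of difference quotients of [Phi1], and
     (V g)(x) = Phi1(0) g(x) + \int_0^l D(x - y) g(y) dy   on L^2(0, l).
   Its adjoint is
     (W f)(y) = Phi1(0)^* f(y) + \int_0^l D(x - y)^* f(x) dx,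
   and Fubini's theorem shows that the kernel [s] is exactly the one making
   S = I + V W. Hence <S f, g> = <f, g> + <W f, W g>, so that S is self-adjoint
   and S >= I, which is also strict positivity with constant 1. *)
Require Import Defs.
From HB Require Import structures.
From mathcomp Require Import all_boot all_order all_algebra.
From mathcomp Require Import complex.
From mathcomp Require Import all_classical all_reals all_analysis.
From mathcomp Require Import measurable_realfun ring lra.

Import Order.TTheory GRing.Theory Num.Theory.
Import numFieldNormedType.Exports.
Local Open Scope classical_set_scope.
Local Open Scope sesquilinear_scope.
Local Open Scope complex_scope.
Local Open Scope ring_scope.

Set Implicit Arguments.
Unset Strict Implicit.
Unset Printing Implicit Defensive.

Local Notation Re := complex.Re.
Local Notation Im := complex.Im.

(** * Measurable and integrable complex functions *)

(** Formally, V g is the derivative in x of the convolution \int_0^x Phi1(x - y) g(y) dy; this is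
    the origin of its constant term and of its kernel. In V W the support of D produces both the
    case distinction in s and the upper limit min(x, t). The obstacle is that D is only bounded and
    measurable, so each exchange of integrals needs a majorant. Majorants of product form u(x) v(y),
    with u and v integrable, are used: they make every section integrable, so that S f = f + V W f
    holds at each point of ]0, l[ and not just almost everywhere. Null sets enter only through the
    identification of functions and through end points of intervals. Membership of S in B(L^2) is
    read off from the same factorization, once V and W are known to be bounded. *)

Lemma Re_add (R : rcfType) (z w : R[i]) : Re (z + w) = Re z + Re w.
Proof. by case: z; case: w. Qed.

Lemma Im_add (R : rcfType) (z w : R[i]) : Im (z + w) = Im z + Im w.
Proof. by case: z; case: w. Qed.

Lemma Re_mul (R : rcfType) (z w : R[i]) : Re (z * w) = Re z * Re w - Im z * Im w.
Proof. by case: z; case: w. Qed.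

Lemma Im_mul (R : rcfType) (z w : R[i]) : Im (z * w) = Re z * Im w + Im z * Re w.
Proof. by case: z; case: w. Qed.

Lemma Re_conjC (R : rcfType) (z : R[i]) : Re z^* = Re z.
Proof. by case: z. Qed.

Lemma Im_conjC (R : rcfType) (z : R[i]) : Im z^* = - Im z.
Proof. by case: z. Qed.

Lemma complex_ext (R : rcfType) (z w : R[i]) : Re z = Re w -> Im z = Im w -> z = w.
Proof. by case: z => a b; case: w => c d /= -> ->. Qed.

Lemma normc_sqr (R : rcfType) (z : R[i]) : Normc.normc z ^+ 2 = Re z ^+ 2 + Im z ^+ 2.
Proof. by case: z => a b /=; rewrite sqr_sqrtr// addr_ge0// sqr_ge0. Qed.

Definition cmeas d (T : measurableType d) (R : realType) (f : T -> R[i]) : Prop :=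
  measurable_fun [set: T] (fun x => Re (f x)) /\
  measurable_fun [set: T] (fun x => Im (f x)).

(** The bound is on the two coordinates, so |Re| + |Im| is at most 2 M; this is where the factors
    [M + M] below come from. *)
Definition cbounded (T : Type) (R : realType) (f : T -> R[i]) : Prop :=
  exists M : R, forall x, `|Re (f x)| <= M /\ `|Im (f x)| <= M.

Section measurable.
Context d (T : measurableType d) (R : realType).
Implicit Types f g : T -> R[i].

Lemma cmeas_cst c : cmeas (fun _ : T => c : R[i]).
Proof. by split; exact: measurable_cst. Qed.

Lemma cmeasD f g : cmeas f -> cmeas g -> cmeas (fun x => f x + g x).
Proof.
move=> [rf jf] [rg jg]; split.
  by under eq_fun do rewrite Re_add; exact: measurable_funD.
by under eq_fun do rewrite Im_add; exact: measurable_funD.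
Qed.

Lemma cmeasM f g : cmeas f -> cmeas g -> cmeas (fun x => f x * g x).
Proof.
move=> [rf jf] [rg jg]; split.
  by under eq_fun do rewrite Re_mul; apply: measurable_funB; exact: measurable_funM.
by under eq_fun do rewrite Im_mul; apply: measurable_funD; exact: measurable_funM.
Qed.

Lemma cmeas_conj f : cmeas f -> cmeas (fun x => (f x)^*).
Proof.
move=> [rf jf]; split.
  by under eq_fun do rewrite Re_conjC.
by under eq_fun do rewrite Im_conjC; exact: measurable_funN.
Qed.

Lemma cmeas_if (A : T -> bool) f : measurable_fun [set: T] A -> cmeas f ->
  cmeas (fun x => if A x then f x else 0).
Proof.
move=> mA [rf jf]; split.
  rewrite [X in measurable_fun _ X](_ : _ = fun x => if A x then Re (f x) else 0).
    by apply: measurable_fun_ifT => //; exact: measurable_cst.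
  by apply/funext => x; case: (A x).
rewrite [X in measurable_fun _ X](_ : _ = fun x => if A x then Im (f x) else 0).
  by apply: measurable_fun_ifT => //; exact: measurable_cst.
by apply/funext => x; case: (A x).
Qed.

End measurable.

Lemma cmeas_comp d1 d2 (T1 : measurableType d1) (T2 : measurableType d2)
    (R : realType) (f : T2 -> R[i]) (g : T1 -> T2) :
  cmeas f -> measurable_fun [set: T1] g -> cmeas (fun x => f (g x)).
Proof.
move=> [rf jf] mg.
by split; [exact: (measurableT_comp rf mg)|exact: (measurableT_comp jf mg)].
Qed.

Section bounded.
Context (T : Type) (R : realType).
Implicit Types f g : T -> R[i].

Lemma cbounded_cst c : cbounded (fun _ : T => c : R[i]).
Proof.
exists (`|Re c| + `|Im c|) => _; split; first by rewrite lerDl.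
by rewrite lerDr.
Qed.

Lemma cboundedD f g : cbounded f -> cbounded g -> cbounded (fun x => f x + g x).
Proof.
move=> [M hf] [N hg]; exists (M + N) => x; rewrite Re_add Im_add.
have [? ?] := hf x; have [? ?] := hg x.
by split; apply: (le_trans (ler_normD _ _)); exact: lerD.
Qed.

Lemma cbounded_conj f : cbounded f -> cbounded (fun x => (f x)^*).
Proof. by move=> [M hf]; exists M => x; rewrite Re_conjC Im_conjC normrN. Qed.

Lemma cbounded_if (A : T -> bool) f : cbounded f ->
  cbounded (fun x => if A x then f x else 0).
Proof.
move=> [M hf]; exists M => x; case: (A x) => //=.
by rewrite normr0; have [h _] := hf x; split; exact: le_trans h.
Qed.

Lemma cbounded_comp (T' : Type) f (g : T' -> T) :
  cbounded f -> cbounded (fun x => f (g x)).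
Proof. by move=> [M hf]; exists M => x. Qed.

End bounded.

Definition cintegrable (R : realType) (f : R -> R[i]) : Prop :=
  (@lebesgue_measure R).-integrable setT (fun x => (Re (f x))%:E) /\
  (@lebesgue_measure R).-integrable setT (fun x => (Im (f x))%:E).

Section integral.
Context (R : realType).
Notation mu := (@lebesgue_measure R).
Implicit Types (f g : R -> R[i]) (c : R[i]).

Lemma cintegrable_cmeas f : cintegrable f -> cmeas f.
Proof.
by move=> [rf jf]; split; apply/measurable_EFinP; apply: (measurable_int mu).
Qed.

Lemma le_cintegrable f (h : R -> R) : cmeas f ->
  (forall x, `|Re (f x)| <= h x /\ `|Im (f x)| <= h x) ->
  mu.-integrable setT (EFin \o h) -> cintegrable f.
Proof.
move=> [rf jf] fh ih; split; apply: (le_integrable _ _ _ ih) => //.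
- exact/measurable_EFinP.
- move=> x _ /=; rewrite lee_fin; have [h1 _] := fh x.
  exact: le_trans h1 (ler_norm _).
- exact/measurable_EFinP.
- move=> x _ /=; rewrite lee_fin; have [_ h1] := fh x.
  exact: le_trans h1 (ler_norm _).
Qed.

Lemma integrable_abs1 f : cintegrable f ->
  mu.-integrable setT (EFin \o (fun x => `|Re (f x)| + `|Im (f x)|)).
Proof.
move=> [rf jf].
have := integrableD measurableT (integrable_abse rf) (integrable_abse jf); exact.
Qed.

Lemma cintegrable0 : cintegrable (fun _ : R => 0 : R[i]).
Proof. by split; exact: integrable0. Qed.

Lemma cintegrableD f g : cintegrable f -> cintegrable g ->
  cintegrable (fun x => f x + g x).
Proof.
move=> [rf jf] [rg jg]; split.
  by under eq_fun do rewrite Re_add EFinD; exact: integrableD.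
by under eq_fun do rewrite Im_add EFinD; exact: integrableD.
Qed.

Lemma cintegrable_conj f : cintegrable f -> cintegrable (fun x => (f x)^*).
Proof.
move=> [rf jf]; split; first by under eq_fun do rewrite Re_conjC.
by under eq_fun do rewrite Im_conjC EFinN; exact: integrableN.
Qed.

Lemma cintegrable_bM (k f : R -> R[i]) : cmeas k -> cbounded k -> cintegrable f ->
  cintegrable (fun x => k x * f x).
Proof.
move=> mk [M bk] fi; have [rf jf] := fi.
apply: (@le_cintegrable _ (fun x => M * (`|Re (f x)| + `|Im (f x)|))).
- by apply: cmeasM => //; exact: cintegrable_cmeas.
- move=> x; have [h1 h2] := bk x; rewrite Re_mul Im_mul mulrDr; split.
    by apply: (le_trans (ler_normB _ _)); rewrite !normrM lerD// ler_pM.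
  rewrite addrC.
  by apply: (le_trans (ler_normD _ _)); rewrite !normrM lerD// ler_pM.
- exact: (integrableZl measurableT M (integrable_abs1 fi)).
Qed.

Lemma cintegrableZ c f : cintegrable f -> cintegrable (fun x => c * f x).
Proof.
move=> fi.
by apply: (cintegrable_bM _ _ fi); [exact: cmeas_cst|exact: cbounded_cst].
Qed.

Lemma cintegrable_sum (I : Type) (r : seq I) (h : I -> R -> R[i]) :
  (forall i, cintegrable (h i)) -> cintegrable (fun x => \sum_(i <- r) h i x).
Proof.
move=> mh; elim: r => [|i r ih].
  by under eq_fun do rewrite big_nil; exact: cintegrable0.
by under eq_fun do rewrite big_cons; exact: cintegrableD.
Qed.

Lemma Cintegral0 : Cintegral setT (fun _ : R => 0 : R[i]) = 0.
Proof. by rewrite /Cintegral /= Rintegral_cst// mul0r. Qed.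

Lemma CintegralD f g : cintegrable f -> cintegrable g ->
  Cintegral setT (fun x => f x + g x) = Cintegral setT f + Cintegral setT g.
Proof.
move=> [rf jf] [rg jg]; apply: complex_ext => /=.
  by under eq_Rintegral do rewrite Re_add; rewrite RintegralD.
by under eq_Rintegral do rewrite Im_add; rewrite RintegralD.
Qed.

Lemma CintegralZ c f : cintegrable f ->
  Cintegral setT (fun x => c * f x) = c * Cintegral setT f.
Proof.
move=> [rf jf]; have iZ (a : R) (h : R -> R) :
  mu.-integrable setT (fun x => (h x)%:E) -> mu.-integrable setT (fun x => (a * h x)%:E).
  by under [X in _ -> mu.-integrable _ X]eq_fun do rewrite EFinM; exact: integrableZl.
apply: complex_ext; rewrite ?Re_mul ?Im_mul /=.
  under eq_Rintegral do rewrite Re_mul.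
  by rewrite RintegralB//; [congr (_ - _); rewrite RintegralZl|exact: iZ..].
under eq_Rintegral do rewrite Im_mul.
by rewrite RintegralD//; [congr (_ + _); rewrite RintegralZl|exact: iZ..].
Qed.

Lemma Cintegral_conj f : cintegrable f ->
  Cintegral setT (fun x => (f x)^*) = (Cintegral setT f)^*.
Proof.
move=> [rf jf]; apply: complex_ext; rewrite ?Re_conjC ?Im_conjC /=.
  by apply: eq_Rintegral => x _; rewrite Re_conjC.
under eq_Rintegral do rewrite Im_conjC -mulN1r.
by rewrite RintegralZl// mulN1r.
Qed.

Lemma Cintegral_sum (I : Type) (r : seq I) (h : I -> R -> R[i]) :
  (forall i, cintegrable (h i)) ->
  Cintegral setT (fun x => \sum_(i <- r) h i x) =
  \sum_(i <- r) Cintegral setT (h i).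
Proof.
move=> mh; elim: r => [|i r ih].
  rewrite big_nil (_ : (fun _ => _) = fun=> 0) ?Cintegral0//.
  by apply/funext => x; rewrite big_nil.
rewrite big_cons -ih -CintegralD//; last exact: cintegrable_sum.
by congr Cintegral; apply/funext => x; rewrite big_cons.
Qed.

End integral.

(** * Fubini's theorem *)

(** The right side expands into the four products of absolute values of coordinates, each of which
    occurs once in a triangle inequality on the left. This norm dominates both coordinates and
    involves no square root, so it replaces the modulus in the majorants. *)
Lemma norm1_mul (R : rcfType) (z w : R[i]) :
  `|Re (z * w)| + `|Im (z * w)| <= (`|Re z| + `|Im z|) * (`|Re w| + `|Im w|).
Proof.
rewrite Re_mul Im_mul; apply: (le_trans (lerD (ler_normB _ _) (ler_normD _ _))).
by rewrite !normrM; lra.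
Qed.

Section fubini.
Context (R : realType).
Notation mu := (@lebesgue_measure R).

Section real_kernel.
Variables (h : R * R -> R) (u v : R -> R).
Hypothesis mh : measurable_fun [set: R * R] h.
Hypothesis iu : mu.-integrable setT (EFin \o u).
Hypothesis iv : mu.-integrable setT (EFin \o v).
Hypothesis huv : forall x y, `|h (x, y)| <= u x * v y.

Let section1_integrable x : mu.-integrable setT (fun y => (h (x, y))%:E).
Proof.
apply: (le_integrable _ _ _ (integrableZl measurableT (u x) iv)) => //.
  by apply/measurable_EFinP; exact: measurableT_comp mh (measurable_pair1 x).
by move=> y _; rewrite /= lee_fin; exact: le_trans (huv x y) (ler_norm _).
Qed.

Let section2_integrable y : mu.-integrable setT (fun x => (h (x, y))%:E).
Proof.
apply: (le_integrable _ _ _ (integrableZl measurableT (v y) iu)) => //.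
  by apply/measurable_EFinP; exact: measurableT_comp mh (measurable_pair2 y).
by move=> x _; rewrite /= lee_fin mulrC; exact: le_trans (huv x y) (ler_norm _).
Qed.

(** Tonelli: the iterated integral of |h| is at most the product of the integrals of |u| and |v|,
    hence finite. *)
Let product_integrable : (mu \x mu)%E.-integrable setT (EFin \o h).
Proof.
have nuv x y : (`|(h (x, y))%:E| <= `|(u x)%:E| * `|(v y)%:E|)%E.
  rewrite /= -EFinM lee_fin -normrM.
  exact: le_trans (huv x y) (ler_norm _).
have mh' : measurable_fun [set: R * R] (EFin \o h) by exact/measurable_EFinP.
apply/(integrable12ltyP mu mu mh').
have fv : (\int[mu]_y `|(v y)%:E| < +oo)%E by have /integrableP[] := iv.
have fu : (\int[mu]_x `|(u x)%:E| < +oo)%E by have /integrableP[] := iu.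
have mu_ : measurable_fun setT (fun x => `|(u x)%:E|)%E.
  by apply: measurableT_comp => //; exact: measurable_int iu.
have mv : measurable_fun setT (fun x => `|(v x)%:E|)%E.
  by apply: measurableT_comp => //; exact: measurable_int iv.
apply: (@le_lt_trans _ _
  (\int[mu]_x (`|(u x)%:E| * \int[mu]_y `|(v y)%:E|))%E).
  apply: ge0_le_integral => //.
  - by move=> x _; exact: integral_ge0.
  - apply: (measurable_fun_fubini_tonelli_F (m2 := mu) (fun z => `|(h z)%:E|)%E) => //.
    exact: measurableT_comp.
  - exact: emeasurable_funM.
  - move=> x _; rewrite -ge0_integralZl//.
    apply: ge0_le_integral => //.
    + apply/measurableT_comp => //; apply/measurable_EFinP.
      exact: measurableT_comp mh (measurable_pair1 x).
    + exact: emeasurable_funM.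
    + by move=> y _; exact: nuv.
rewrite ge0_integralZr ?integral_ge0//.
by rewrite lte_mul_pinfty ?integral_ge0// ge0_fin_numE ?integral_ge0.
Qed.

Lemma integrable_Rintegral :
  mu.-integrable setT (fun x => (\int[mu]_y h (x, y))%:E).
Proof.
(* Every section is integrable, so the extended inner integral is finite at each x and agrees with
   the real one everywhere. *)
rewrite (_ : (fun _ => _) = fubini_F mu (EFin \o h)).
  exact: integrable_fubini_F.
by apply/funext => x; rewrite /Rintegral fineK// integrable_fin_num.
Qed.

Lemma Rintegral_swap :
  \int[mu]_x \int[mu]_y h (x, y) = \int[mu]_y \int[mu]_x h (x, y).
Proof.
rewrite /Rintegral; congr fine.
transitivity (\int[mu]_x \int[mu]_y (EFin \o h) (x, y))%E.
  by apply: eq_integral => x _; rewrite fineK// integrable_fin_num.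
rewrite Fubini//.
by apply: eq_integral => x _; rewrite fineK// integrable_fin_num.
Qed.

Lemma le_norm_Rintegral x :
  `|\int[mu]_y h (x, y)| <= u x * \int[mu]_y v y.
Proof.
apply: (le_trans (le_normr_Rintegral measurableT (section1_integrable x))).
rewrite -(RintegralZl (u x) measurableT iv); apply: le_Rintegral => //.
  exact: (integrable_abse (section1_integrable x)).
exact: (integrableZl measurableT (u x) iv).
Qed.

End real_kernel.

(** The product majorant is what the exchange of integrals consumes. The signs of u and v serve
    sums: u v + w t is at most (u + w) (v + t) once the cross terms are nonnegative. *)
Definition cdominated (h : R * R -> R[i]) : Prop :=
  cmeas h /\ exists u v : R -> R,
  [/\ mu.-integrable setT (EFin \o u), mu.-integrable setT (EFin \o v),
      forall x, 0 <= u x, forall y, 0 <= v y &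
      forall x y, `|Re (h (x, y))| <= u x * v y /\ `|Im (h (x, y))| <= u x * v y].

Lemma Cintegral_swap (h : R * R -> R[i]) : cdominated h ->
  Cintegral setT (fun x => Cintegral setT (fun y => h (x, y))) =
  Cintegral setT (fun y => Cintegral setT (fun x => h (x, y))).
Proof.
move=> [[rh jh] [u [v [iu iv _ _ huv]]]]; apply: complex_ext => /=.
  by apply: (Rintegral_swap rh iu iv) => x y; have [] := huv x y.
by apply: (Rintegral_swap jh iu iv) => x y; have [] := huv x y.
Qed.

Lemma cintegrable_Cintegral (h : R * R -> R[i]) : cdominated h ->
  cintegrable (fun x => Cintegral setT (fun y => h (x, y))).
Proof.
move=> [[rh jh] [u [v [iu iv _ _ huv]]]]; split => /=.
  by apply: (integrable_Rintegral rh iu iv) => x y; have [] := huv x y.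
by apply: (integrable_Rintegral jh iu iv) => x y; have [] := huv x y.
Qed.

Lemma cdominated0 : cdominated (fun _ => 0).
Proof.
split; first exact: cmeas_cst.
exists (fun=> 0), (fun=> 0); split=> //; try exact: integrable0.
by move=> x y; rewrite /= normr0 mul0r.
Qed.

Lemma cdominatedD (h k : R * R -> R[i]) : cdominated h -> cdominated k ->
  cdominated (fun z => h z + k z).
Proof.
move=> [mh [u [v [iu iv u0 v0 huv]]]] [mk [w [t [iw it w0 t0 kwt]]]].
split; first exact: cmeasD.
exists (fun x => u x + w x), (fun x => v x + t x); split.
- exact: (integrableD measurableT iu iw).
- exact: (integrableD measurableT iv it).
- by move=> x; rewrite addr_ge0.
- by move=> x; rewrite addr_ge0.
- move=> x y; rewrite Re_add Im_add; have [h1 h2] := huv x y; have [k1 k2] := kwt x y.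
  have le a b : `|a| <= u x * v y -> `|b| <= w x * t y ->
      `|a + b| <= (u x + w x) * (v y + t y).
    move=> ha hb; apply: (le_trans (ler_normD _ _)).
    apply: (le_trans (lerD ha hb)).
    have := mulr_ge0 (u0 x) (t0 y); have := mulr_ge0 (w0 x) (v0 y).
    rewrite mulrDl !mulrDr; lra.
  by split; exact: le.
Qed.

Lemma cdominated_sum (I : Type) (r : seq I) (h : I -> R * R -> R[i]) :
  (forall i, cdominated (h i)) -> cdominated (fun z => \sum_(i <- r) h i z).
Proof.
move=> mh; elim: r => [|i r ih].
  by under eq_fun do rewrite big_nil; exact: cdominated0.
by under eq_fun do rewrite big_cons; exact: cdominatedD.
Qed.

Lemma cdominatedM (k : R * R -> R[i]) (f g : R -> R[i]) :
  cmeas k -> cbounded k -> cintegrable f -> cintegrable g ->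
  cdominated (fun z => f z.1 * k z * g z.2).
Proof.
move=> mk bk fi gi; split.
  apply: cmeasM; first apply: cmeasM => //.
    exact: cmeas_comp (cintegrable_cmeas fi) measurable_fst.
  exact: cmeas_comp (cintegrable_cmeas gi) measurable_snd.
have [M bM] := bk.
(* [M + M] bounds |Re k| + |Im k|; it is put into the factor in y. *)
exists (fun x => `|Re (f x)| + `|Im (f x)|),
  (fun y => (M + M) * (`|Re (g y)| + `|Im (g y)|)).
split.
- exact: integrable_abs1.
- exact: (integrableZl measurableT (M + M) (integrable_abs1 gi)).
- by move=> x; rewrite addr_ge0.
- move=> x; have [b1 _] := bM (x, x); have M0 := le_trans (normr_ge0 _) b1.
  by rewrite mulr_ge0 ?addr_ge0.
- move=> x y /=; have [b1 b2] := bM (x, y).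
  suff le : `|Re (f x * k (x, y) * g y)| + `|Im (f x * k (x, y) * g y)| <=
      (`|Re (f x)| + `|Im (f x)|) * ((M + M) * (`|Re (g y)| + `|Im (g y)|)).
    by split; apply: le_trans le; rewrite (lerDl, lerDr).
  apply: (le_trans (norm1_mul _ _)); rewrite mulrA ler_wpM2r ?addr_ge0//.
  apply: (le_trans (norm1_mul _ _)); rewrite ler_wpM2l ?addr_ge0//.
  exact: lerD.
Qed.
End fubini.

(** * Square-integrable functions on an interval *)

(* Elements of L^2(0, l) are extended by 0 to the whole line, so that all integrals
   are over the line and Fubini's theorem applies without domains. *)
Definition sqint (R : realType) (l : R) (f : R -> R[i]) : Prop :=
  [/\ cmeas f,
      (@lebesgue_measure R).-integrable setT (fun x => (Normc.normc (f x) ^+ 2)%:E) &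
      forall x, x \notin `]0, l[ -> f x = 0].

Section square_integrable.
Context (R : realType) (l : R).
Hypothesis l0 : 0 < l.
Notation mu := (@lebesgue_measure R).
Implicit Types (f g : R -> R[i]).

Lemma measurable_mem_itv (i : interval R) :
  measurable_fun [set: R] (fun x : R => x \in i).
Proof.
apply: (measurable_fun_bool true); rewrite setTI.
by rewrite (_ : _ @^-1` _ = [set` i])//; apply/seteqP; split.
Qed.

Lemma if_itv_patch (i : interval R) (h : R -> R) :
  (fun x => if x \in i then h x else 0) = h \_ [set` i].
Proof. by apply/funext => x; rewrite patchE mem_setE. Qed.

Lemma integrable_step (c : R) :
  mu.-integrable setT (EFin \o (fun x => if x \in `]0, l[ then c else 0)).
Proof.
rewrite if_itv_patch -restrict_EFin; apply/integrable_restrict => //.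
rewrite setTI; apply: measurable_bounded_integrable => //.
- by rewrite /= lebesgue_measure_itv/= lte_fin l0 -EFinB ltry.
- by exists `|c|; split; rewrite ?num_real// => M cM x _; exact: ltW.
Qed.

Lemma Rintegral_step (c : R) :
  \int[mu]_x (if x \in `]0, l[ then c else 0) = c * l.
Proof.
rewrite [LHS](_ : _ = \int[mu]_(x in `]0, l[) c).
  by rewrite Rintegral_cst//= lebesgue_measure_itv/= lte_fin l0 /= subr0.
by rewrite [RHS]Rintegral_mkcond -if_itv_patch.
Qed.

Lemma le_sqint f (h : R -> R) : cmeas f ->
  (forall x, x \notin `]0, l[ -> f x = 0) ->
  (forall x, Normc.normc (f x) ^+ 2 <= h x) ->
  mu.-integrable setT (EFin \o h) -> sqint l f.
Proof.
move=> mf f0 fh ih; split=> //; apply: (le_integrable _ _ _ ih) => //.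
  under eq_fun do rewrite normc_sqr; have [rf jf] := mf.
  by apply/measurable_EFinP; apply: measurable_funD; exact: measurable_funX.
move=> x _ /=; rewrite lee_fin ger0_norm ?sqr_ge0//.
exact: le_trans (fh x) (ler_norm _).
Qed.

(** The parallelogram law with the term |z - w|^2 dropped. *)
Lemma normc_sqrD (z w : R[i]) : Normc.normc (z + w) ^+ 2 <=
  2 * Normc.normc z ^+ 2 + 2 * Normc.normc w ^+ 2.
Proof.
rewrite !normc_sqr Re_add Im_add.
have := sqr_ge0 (Re z - Re w); have := sqr_ge0 (Im z - Im w).
by lra.
Qed.

Lemma normc_sqr_le (z : R[i]) (M : R) : `|Re z| <= M -> `|Im z| <= M ->
  Normc.normc z ^+ 2 <= 2 * M ^+ 2.
Proof.
move=> h1 h2.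
rewrite normc_sqr -(real_normK (num_real (Re z))) -(real_normK (num_real (Im z))).
by rewrite mulr2n mulrDl mul1r lerD// lerXn2r// nnegrE; apply: le_trans h1.
Qed.

Lemma sqint0 : sqint l (fun _ => 0).
Proof.
apply: (@le_sqint _ (fun=> 0)) => //.
  by move=> x; rewrite Normc.normc0 expr0n.
exact: integrable0.
Qed.

Lemma sqintD f g : sqint l f -> sqint l g -> sqint l (fun x => f x + g x).
Proof.
move=> [mf fi f0] [mg gi g0].
apply: (@le_sqint _ (fun x => 2 * Normc.normc (f x) ^+ 2 + 2 * Normc.normc (g x) ^+ 2)).
- exact: cmeasD.
- by move=> x xl; rewrite f0// g0// addr0.
- by move=> x; exact: normc_sqrD.
- exact: (integrableD measurableT (integrableZl measurableT 2 fi)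
    (integrableZl measurableT 2 gi)).
Qed.

Lemma sqint_bM (k : R -> R[i]) f : cmeas k -> cbounded k -> sqint l f ->
  sqint l (fun x => k x * f x).
Proof.
move=> mk [M bk] [mf fi f0].
apply: (@le_sqint _ (fun x => 2 * M ^+ 2 * Normc.normc (f x) ^+ 2)).
- exact: cmeasM.
- by move=> x xl; rewrite f0// mulr0.
- move=> x; rewrite Normc.normcM exprMn ler_wpM2r ?sqr_ge0//.
  by have [h1 h2] := bk x; exact: normc_sqr_le.
- exact: (integrableZl measurableT _ fi).
Qed.

Lemma sqintZ c f : sqint l f -> sqint l (fun x => c * f x).
Proof.
by move=> fi; apply: (sqint_bM _ _ fi); [exact: cmeas_cst|exact: cbounded_cst].
Qed.

Lemma sqint_sum (I : Type) (r : seq I) (h : I -> R -> R[i]) :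
  (forall i, sqint l (h i)) -> sqint l (fun x => \sum_(i <- r) h i x).
Proof.
move=> mh; elim: r => [|i r ih].
  by under eq_fun do rewrite big_nil; exact: sqint0.
by under eq_fun do rewrite big_cons; exact: sqintD.
Qed.

Lemma sqint_conj f : sqint l f -> sqint l (fun x => (f x)^*).
Proof.
move=> [mf fi f0]; split; first exact: cmeas_conj.
  by under eq_fun do rewrite normc_sqr Re_conjC Im_conjC sqrrN -normc_sqr.
by move=> x xl; rewrite f0// conjC0.
Qed.

Lemma bounded_sqint f : cmeas f -> cbounded f ->
  (forall x, x \notin `]0, l[ -> f x = 0) -> sqint l f.
Proof.
move=> mf [M bf] f0.
apply: (le_sqint mf f0 _ (integrable_step (2 * M ^+ 2))) => x.
case: ifPn => [xl|/f0->]; last by rewrite Normc.normc0 expr0n.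
by have [h1 h2] := bf x; exact: normc_sqr_le.
Qed.

Lemma sqintM_cintegrable f g : sqint l f -> sqint l g ->
  cintegrable (fun x => f x * g x).
Proof.
move=> [mf fi f0] [mg gi g0].
apply: (@le_cintegrable _ _ (fun x => Normc.normc (f x) ^+ 2 + Normc.normc (g x) ^+ 2)).
- exact: cmeasM.
- move=> x; rewrite Re_mul Im_mul !normc_sqr !ler_norml.
  move: (Re (f x)) (Im (f x)) (Re (g x)) (Im (g x)) => a b c d.
  (* Each product of coordinates, with either sign, is at most half a sum of two squares; the eight
     squares cover the four products. *)
  have := sqr_ge0 (a + c); have := sqr_ge0 (a - c).
  have := sqr_ge0 (a + d); have := sqr_ge0 (a - d).
  have := sqr_ge0 (b + c); have := sqr_ge0 (b - c).
  have := sqr_ge0 (b + d); have := sqr_ge0 (b - d).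
  by split; apply/andP; split; lra.
- exact: (integrableD measurableT fi gi).
Qed.

(** The interval has finite length, so its indicator is square-integrable, and f is the product of f
    with it. *)
Lemma sqint_cintegrable f : sqint l f -> cintegrable f.
Proof.
move=> sf; have [mf fi f0] := sf.
have s1 : sqint l (fun x => if x \in `]0, l[ then 1 else 0).
  apply: bounded_sqint.
  - by apply: cmeas_if; [exact: measurable_mem_itv|exact: cmeas_cst].
  - by apply: cbounded_if; exact: cbounded_cst.
  - by move=> x /negbTE ->.
rewrite (_ : f = fun x => f x * (if x \in `]0, l[ then 1 else 0)).
  exact: sqintM_cintegrable.
by apply/funext => x; case: ifPn => [_|/f0->]; rewrite ?mulr1 ?mul0r.
Qed.

Lemma norm1_sqr_le (z : R[i]) :
  (`|Re z| + `|Im z|) ^+ 2 <= 2 * Normc.normc z ^+ 2.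
Proof.
rewrite normc_sqr -(real_normK (num_real (Re z))) -(real_normK (num_real (Im z))).
by have := sqr_ge0 (`|Re z| - `|Im z|); lra.
Qed.

Lemma sqr_Rintegral_norm1 f : sqint l f ->
  (\int[mu]_x (`|Re (f x)| + `|Im (f x)|)) ^+ 2 <=
  2 * l * \int[mu]_x (Normc.normc (f x) ^+ 2).
Proof.
move=> sf; have [mf fi f0] := sf.
have i1 := integrable_abs1 (sqint_cintegrable sf).
(* Cauchy-Schwarz: integrate [2 a g <= g^2 + a^2] on ]0, l[ with [a] the mean of [g]. *)
set A := Rintegral _ _ _; set a := A / l.
have : \int[mu]_x (2 * a * (`|Re (f x)| + `|Im (f x)|)) <=
  \int[mu]_x (2 * Normc.normc (f x) ^+ 2 + (if x \in `]0, l[ then a ^+ 2 else 0)).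
  apply: le_Rintegral => //.
  - exact: (integrableZl measurableT _ i1).
  - exact: (integrableD measurableT (integrableZl measurableT _ fi)
      (integrable_step _)).
  - move=> x _; case: ifPn => [_|/f0 ->]; last first.
      by rewrite Normc.normc0 !normr0 !addr0 mulr0 expr0n mulr0.
    have := sqr_ge0 (`|Re (f x)| + `|Im (f x)| - a).
    have := norm1_sqr_le (f x).
    by lra.
rewrite (RintegralZl _ measurableT i1).
rewrite (RintegralD measurableT (integrableZl measurableT 2 fi)
  (integrable_step (a ^+ 2))).
rewrite (RintegralZl _ measurableT fi) Rintegral_step -/A.
rewrite (_ : A = a * l); last by rewrite /a divfK// gt_eqF.
set N := Rintegral _ _ _ => h.
(* As A = a l, the integrated inequality amounts to a^2 l <= 2 N; multiplied by l > 0 it becomes A^2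
   <= 2 l N. The factor 2 is that of [norm1_sqr_le]. *)
have : l * (2 * a * (a * l)) <= l * (2 * N + a ^+ 2 * l) by rewrite ler_pM2l.
by lra.
Qed.

End square_integrable.

(** * Matrix-valued functions *)

(** The section estimate is taken with the constant u = 2 M, a bound for |Re k| + |Im k|, so the
    result does not depend on x. *)
Lemma le_Cintegral_kernel (R : realType) (k : R * R -> R[i]) (M : R) (f : R -> R[i]) x :
  cmeas k -> (forall z, `|Re (k z)| <= M /\ `|Im (k z)| <= M) -> cintegrable f ->
  let A := (M + M) * \int[@lebesgue_measure R]_y (`|Re (f y)| + `|Im (f y)|) in
  `|Re (Cintegral setT (fun y => k (x, y) * f y))| <= A /\
  `|Im (Cintegral setT (fun y => k (x, y) * f y))| <= A.
Proof.
move=> mk bk fi A; have i1 := integrable_abs1 fi.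
have [mr mi] : cmeas (fun z : R * R => k z * f z.2).
  by apply: cmeasM => //; exact: cmeas_comp (cintegrable_cmeas fi) measurable_snd.
have le x' y : `|Re (k (x', y) * f y)| + `|Im (k (x', y) * f y)| <=
    (M + M) * (`|Re (f y)| + `|Im (f y)|).
  apply: (le_trans (norm1_mul _ _)); rewrite ler_wpM2r ?addr_ge0//.
  by have [? ?] := bk (x', y); exact: lerD.
split.
  apply: (le_norm_Rintegral (u := fun=> M + M) mr i1) => x' y.
  by apply: le_trans (le x' y); rewrite lerDl.
apply: (le_norm_Rintegral (u := fun=> M + M) mi i1) => x' y.
by apply: le_trans (le x' y); rewrite lerDr.
Qed.

Section matrix.
Context (R : realType) (l : R).
Hypothesis l0 : 0 < l.
Notation mu := (@lebesgue_measure R).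

Definition mx_bmeas d (T : measurableType d) m n (F : T -> 'M[R[i]]_(m, n)) : Prop :=
  forall i j, cmeas (fun x => F x i j) /\ cbounded (fun x => F x i j).

Definition mx_cintegrable m n (F : R -> 'M[R[i]]_(m, n)) : Prop :=
  forall i j, cintegrable (fun x => F x i j).

Definition mx_sqint m n (F : R -> 'M[R[i]]_(m, n)) : Prop :=
  forall i j, sqint l (fun x => F x i j).

Definition mx_cdominated m n (F : R * R -> 'M[R[i]]_(m, n)) : Prop :=
  forall i j, cdominated (fun z => F z i j).

Lemma mulmx_entry (T : Type) m n p (F : T -> 'M[R[i]]_(m, n))
    (G : T -> 'M[R[i]]_(n, p)) i j :
  (fun x => (F x *m G x) i j) = (fun x => \sum_k F x i k * G x k j).
Proof. by apply/funext => x; rewrite mxE. Qed.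

Lemma adjmx_entry (T : Type) m n (F : T -> 'M[R[i]]_(m, n)) i j :
  (fun x => (F x)^t* i j) = (fun x => (F x j i)^*).
Proof. by apply/funext => x; rewrite !mxE. Qed.

Lemma addmx_entry (T : Type) m n (F G : T -> 'M[R[i]]_(m, n)) i j :
  (fun x => (F x + G x) i j) = (fun x => F x i j + G x i j).
Proof. by apply/funext => x; rewrite mxE. Qed.

Lemma adjmxM m n p (A : 'M[R[i]]_(m, n)) (B : 'M[R[i]]_(n, p)) :
  (A *m B)^t* = B^t* *m A^t*.
Proof. by rewrite trmx_mul map_mxM. Qed.

Lemma adjmxD m n (A B : 'M[R[i]]_(m, n)) : (A + B)^t* = A^t* + B^t*.
Proof. by rewrite raddfD map_mxD. Qed.

Lemma mx_bmeas_cst d (T : measurableType d) m n (A : 'M[R[i]]_(m, n)) :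
  mx_bmeas (fun _ : T => A).
Proof. by move=> i j; split; [exact: cmeas_cst|exact: cbounded_cst]. Qed.

Lemma mx_bmeas_adj d (T : measurableType d) m n (F : T -> 'M[R[i]]_(m, n)) :
  mx_bmeas F -> mx_bmeas (fun x => (F x)^t*).
Proof.
move=> bF i j; have [mF bdF] := bF j i; rewrite adjmx_entry.
by split; [exact: cmeas_conj|exact: cbounded_conj].
Qed.

Lemma mx_bmeas_comp d (T : measurableType d) d' (T' : measurableType d') m n
    (F : T -> 'M[R[i]]_(m, n)) (g : T' -> T) :
  mx_bmeas F -> measurable_fun setT g -> mx_bmeas (fun x => F (g x)).
Proof.
move=> bF mg i j; have [mF bdF] := bF i j.
by split; [exact: (cmeas_comp mF mg)|exact: (cbounded_comp g bdF)].
Qed.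

Lemma mx_sqint_cintegrable m n (F : R -> 'M[R[i]]_(m, n)) :
  mx_sqint F -> mx_cintegrable F.
Proof. by move=> sF i j; exact: sqint_cintegrable (sF i j). Qed.

Lemma mx_cintegrable_bM m n p (K : R -> 'M[R[i]]_(m, n)) (F : R -> 'M[R[i]]_(n, p)) :
  mx_bmeas K -> mx_cintegrable F -> mx_cintegrable (fun x => K x *m F x).
Proof.
move=> bK iF i j; rewrite mulmx_entry; apply: cintegrable_sum => k.
by have [mK bdK] := bK i k; exact: cintegrable_bM.
Qed.

Lemma mx_cintegrable_Mb m n p (F : R -> 'M[R[i]]_(m, n)) (K : R -> 'M[R[i]]_(n, p)) :
  mx_cintegrable F -> mx_bmeas K -> mx_cintegrable (fun x => F x *m K x).
Proof.
move=> iF bK i j; rewrite mulmx_entry; apply: cintegrable_sum => k.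
have [mK bdK] := bK k j.
by under eq_fun do rewrite mulrC; exact: cintegrable_bM.
Qed.

Lemma mx_cintegrable_adj m n (F : R -> 'M[R[i]]_(m, n)) :
  mx_cintegrable F -> mx_cintegrable (fun x => (F x)^t*).
Proof. by move=> iF i j; rewrite adjmx_entry; exact: cintegrable_conj. Qed.

Lemma mx_cintegrableD m n (F G : R -> 'M[R[i]]_(m, n)) :
  mx_cintegrable F -> mx_cintegrable G -> mx_cintegrable (fun x => F x + G x).
Proof. by move=> iF iG i j; rewrite addmx_entry; exact: cintegrableD. Qed.

Lemma mx_sqint_bM m n p (K : R -> 'M[R[i]]_(m, n)) (F : R -> 'M[R[i]]_(n, p)) :
  mx_bmeas K -> mx_sqint F -> mx_sqint (fun x => K x *m F x).
Proof.
move=> bK iF i j; rewrite mulmx_entry; apply: sqint_sum => k.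
by have [mK bdK] := bK i k; exact: sqint_bM.
Qed.

Lemma mx_sqint_adj m n (F : R -> 'M[R[i]]_(m, n)) :
  mx_sqint F -> mx_sqint (fun x => (F x)^t*).
Proof. by move=> iF i j; rewrite adjmx_entry; exact: sqint_conj. Qed.

Lemma mx_sqintD m n (F G : R -> 'M[R[i]]_(m, n)) :
  mx_sqint F -> mx_sqint G -> mx_sqint (fun x => F x + G x).
Proof. by move=> iF iG i j; rewrite addmx_entry; exact: sqintD. Qed.

Lemma mx_sqintM m n p (F : R -> 'M[R[i]]_(m, n)) (G : R -> 'M[R[i]]_(n, p)) :
  mx_sqint F -> mx_sqint G -> mx_cintegrable (fun x => F x *m G x).
Proof.
move=> sF sG i j; rewrite mulmx_entry; apply: cintegrable_sum => k.
exact: sqintM_cintegrable.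
Qed.

Lemma mx_sqint_out m n (F : R -> 'M[R[i]]_(m, n)) x :
  mx_sqint F -> x \notin `]0, l[ -> F x = 0.
Proof. by move=> sF xl; apply/matrixP => i j; rewrite mxE; have [_ _ ->] := sF i j. Qed.

Lemma mxintegralM m n p (A : 'M[R[i]]_(m, n)) (F : R -> 'M[R[i]]_(n, p)) :
  mx_cintegrable F ->
  mxintegral setT (fun x => A *m F x) = A *m mxintegral setT F.
Proof.
move=> iF; apply/matrixP => i j; rewrite !mxE mulmx_entry Cintegral_sum.
  by apply: eq_bigr => k _; rewrite mxE CintegralZ.
by move=> k; exact: cintegrableZ.
Qed.

Lemma mxintegralMr m n p (F : R -> 'M[R[i]]_(m, n)) (A : 'M[R[i]]_(n, p)) :
  mx_cintegrable F ->
  mxintegral setT (fun x => F x *m A) = mxintegral setT F *m A.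
Proof.
move=> iF; apply/matrixP => i j; rewrite !mxE mulmx_entry Cintegral_sum.
  apply: eq_bigr => k _; rewrite mxE mulrC -CintegralZ//.
  by congr Cintegral; apply/funext => x; rewrite mulrC.
by move=> k; under eq_fun do rewrite mulrC; exact: cintegrableZ.
Qed.

Lemma mxintegralD m n (F G : R -> 'M[R[i]]_(m, n)) :
  mx_cintegrable F -> mx_cintegrable G ->
  mxintegral setT (fun x => F x + G x) = mxintegral setT F + mxintegral setT G.
Proof.
by move=> iF iG; apply/matrixP => i j; rewrite !mxE addmx_entry CintegralD.
Qed.

Lemma mxintegral_adj m n (F : R -> 'M[R[i]]_(m, n)) : mx_cintegrable F ->
  (mxintegral setT F)^t* = mxintegral setT (fun x => (F x)^t*).
Proof.
by move=> iF; apply/matrixP => i j; rewrite !mxE adjmx_entry Cintegral_conj.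
Qed.

Lemma mxintegral_swap m n (H : R * R -> 'M[R[i]]_(m, n)) : mx_cdominated H ->
  mxintegral setT (fun x => mxintegral setT (fun y => H (x, y))) =
  mxintegral setT (fun y => mxintegral setT (fun x => H (x, y))).
Proof.
move=> dH; apply/matrixP => i j; rewrite !mxE.
transitivity (Cintegral setT (fun x => Cintegral setT (fun y => H (x, y) i j))).
  by congr Cintegral; apply/funext => x; rewrite mxE.
rewrite (Cintegral_swap (dH i j)).
by congr Cintegral; apply/funext => x; rewrite mxE.
Qed.

Lemma mx_cdominatedM m n p q (F : R -> 'M[R[i]]_(m, n))
    (K : R * R -> 'M[R[i]]_(n, p)) (G : R -> 'M[R[i]]_(p, q)) :
  mx_cintegrable F -> mx_bmeas K -> mx_cintegrable G ->
  mx_cdominated (fun z => F z.1 *m K z *m G z.2).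
Proof.
move=> iF bK iG i j.
rewrite (_ : (fun _ => _) =
    fun z => \sum_a \sum_b F z.1 i b * K z b a * G z.2 a j).
  apply: cdominated_sum => a; apply: cdominated_sum => b.
  by have [mK bdK] := bK b a; exact: cdominatedM (iF i b) (iG a j).
apply/funext => z; rewrite mxE; apply: eq_bigr => a _.
by rewrite mxE mulr_suml.
Qed.

End matrix.

(** * Integral operators with bounded kernel *)

Section kernel_operator.
Context (R : realType) (l : R).
Hypothesis l0 : 0 < l.
Notation mu := (@lebesgue_measure R).

(** A bounded measurable function on a bounded interval is square-integrable, and
    [le_Cintegral_kernel] supplies the bound. *)
Lemma sqint_kernel (k : R * R -> R[i]) (f : R -> R[i]) :
  cmeas k -> cbounded k -> cintegrable f ->
  sqint l (fun x => if x \in `]0, l[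
                    then Cintegral setT (fun y => k (x, y) * f y) else 0).
Proof.
move=> mk bk fi; apply: bounded_sqint => //; last by move=> x /negbTE ->.
  have s1 : sqint l (fun x => if x \in `]0, l[ then 1 else 0).
    apply: bounded_sqint => //.
    - by apply: cmeas_if; [exact: measurable_mem_itv|exact: cmeas_cst].
    - by apply: cbounded_if; exact: cbounded_cst.
    - by move=> x /negbTE ->.
  (* The indicator of ]0, l[ is moved under the integral, where it is the integrable factor in x;
     measurability in x then comes from Fubini's theorem. *)
  rewrite (_ : (fun _ => _) = fun x => Cintegral setT (fun y =>
      (if x \in `]0, l[ then 1 else 0) * k (x, y) * f y)).
    apply: cintegrable_cmeas.
    exact: (cintegrable_Cintegral (cdominatedM mk bk (sqint_cintegrable l0 s1) fi)).
  apply/funext => x; case: ifPn => _.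
    by congr Cintegral; apply/funext => y; rewrite mul1r.
  rewrite -[LHS](Cintegral0 R).
  by congr Cintegral; apply/funext => y; rewrite !mul0r.
have [M bM] := bk.
apply: cbounded_if.
exists ((M + M) * \int[mu]_y (`|Re (f y)| + `|Im (f y)|)) => x.
exact: le_Cintegral_kernel.
Qed.

Lemma cmeas_pair1 (k : R * R -> R[i]) x : cmeas k -> cmeas (fun y => k (x, y)).
Proof.
by move=> mk; exact: (cmeas_comp mk (@pair1_measurable _ _ R R x)).
Qed.

Lemma cmeas_swap (k : R * R -> R[i]) : cmeas k -> cmeas (fun z => k (z.2, z.1)).
Proof.
by move=> mk; exact: (cmeas_comp mk (@measurable_swap _ _ R R)).
Qed.

Lemma cdominated_swap (h : R * R -> R[i]) :
  cdominated h -> cdominated (fun z => h (z.2, z.1)).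
Proof.
move=> [mh [u [v [iu iv u0 v0 huv]]]]; split; first exact: cmeas_swap.
by exists v, u; split=> // x y; rewrite mulrC /=; exact: huv.
Qed.

Lemma mx_bmeas_pair1 m n (K : R * R -> 'M[R[i]]_(m, n)) x :
  mx_bmeas K -> mx_bmeas (fun y => K (x, y)).
Proof.
move=> bK i j; have [mK bdK] := bK i j; split; first exact: (cmeas_pair1 x mK).
exact: (cbounded_comp (pair x) bdK).
Qed.

Lemma mx_bmeas_swap m n (K : R * R -> 'M[R[i]]_(m, n)) :
  mx_bmeas K -> mx_bmeas (fun z => K (z.2, z.1)).
Proof.
move=> bK i j; have [mK bdK] := bK i j; split; first exact: (cmeas_swap mK).
exact: (cbounded_comp (fun z => (z.2, z.1)) bdK).
Qed.

(** F is meant to vanish off ]0, l[, so the integral over the line is one over the interval. The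
    value 0 off the interval puts the result in the same class, so that such operators compose. *)
Definition kernel_op m n (C : 'M[R[i]]_(m, n)) (K : R * R -> 'M[R[i]]_(m, n))
    (F : R -> 'cV[R[i]]_n) (x : R) : 'cV[R[i]]_m :=
  if x \in `]0, l[ then C *m F x + mxintegral setT (fun y => K (x, y) *m F y)
  else 0.

Lemma kernel_opE m n (C : 'M[R[i]]_(m, n)) K (F : R -> 'cV[R[i]]_n) i j :
  mx_bmeas K -> mx_sqint l F ->
  (fun x => kernel_op C K F x i j) = (fun x => \sum_k (C i k * F x k j +
     (if x \in `]0, l[ then Cintegral setT (fun y => K (x, y) i k * F y k j) else 0))).
Proof.
move=> bK sF; apply/funext => x; rewrite /kernel_op; case: ifPn => xl.
  rewrite !mxE big_split/=; congr (_ + _).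
  rewrite mulmx_entry Cintegral_sum// => k.
  have [mK bdK] := bK i k.
  apply: cintegrable_bM; last exact: sqint_cintegrable (sF k j).
    exact: (cmeas_pair1 x mK).
  exact: (cbounded_comp (fun y => (x, y)) bdK).
rewrite mxE big1// => k _; rewrite addr0.
by have [_ _ ->] := sF k j; rewrite ?mulr0.
Qed.

Lemma kernel_op_sqint m n (C : 'M[R[i]]_(m, n)) K (F : R -> 'cV[R[i]]_n) :
  mx_bmeas K -> mx_sqint l F -> mx_sqint l (kernel_op C K F).
Proof.
move=> bK sF i j; rewrite kernel_opE//; apply: sqint_sum => k; apply: sqintD.
  exact: sqintZ.
have [mK bdK] := bK i k.
exact: (sqint_kernel mK bdK (sqint_cintegrable l0 (sF k j))).
Qed.

(** Once the outer factor is moved under the inner integral, both sides contain the integral of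
    G(x)^* K(x, y) F(y) over the plane, in the two orders. The cut-off in [kernel_op] costs nothing,
    because the result is paired with a function that vanishes off ]0, l[. *)
Lemma kernel_op_adj m n (C : 'M[R[i]]_(m, n)) K (F : R -> 'cV[R[i]]_n)
    (G : R -> 'cV[R[i]]_m) :
  mx_bmeas K -> mx_sqint l F -> mx_sqint l G ->
  mxintegral setT (fun x => (G x)^t* *m kernel_op C K F x) =
  mxintegral setT (fun y =>
    (kernel_op (C^t*) (fun z => (K (z.2, z.1))^t*) G y)^t* *m F y).
Proof.
move=> bK sF sG.
have iF := mx_sqint_cintegrable l0 sF; have iG := mx_sqint_cintegrable l0 sG.
have bK1 x : mx_bmeas (fun y => K (x, y)) := mx_bmeas_pair1 x bK.
have bK2 y : mx_bmeas (fun x => K (x, y)) := mx_bmeas_pair1 y (mx_bmeas_swap bK).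
have iGa := mx_cintegrable_adj iG.
have dH := mx_cdominatedM iGa bK iF.
have iGCF : mx_cintegrable (fun x => (G x)^t* *m (C *m F x)).
  apply: mx_sqintM; first exact: mx_sqint_adj.
  by apply: mx_sqint_bM => //; exact: mx_bmeas_cst.
have E1 : (fun x => (G x)^t* *m kernel_op C K F x) =
    (fun x => (G x)^t* *m (C *m F x) +
      mxintegral setT (fun y => (G x)^t* *m K (x, y) *m F y)).
  apply/funext => x; rewrite /kernel_op; case: ifPn => xl.
    rewrite mulmxDr -mxintegralM//; last exact: mx_cintegrable_bM.
    by congr (_ + mxintegral _ _); apply/funext => y; rewrite mulmxA.
  rewrite (mx_sqint_out sG xl) trmx0 map_mx0 !mul0mx add0r.
  apply/matrixP => i j; rewrite !mxE -[LHS](Cintegral0 R).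
  by congr Cintegral; apply/funext => y; rewrite !mul0mx mxE.
have E2 : (fun y => (kernel_op (C^t*) (fun z => (K (z.2, z.1))^t*) G y)^t* *m F y) =
    (fun y => (G y)^t* *m (C *m F y) +
      mxintegral setT (fun x => (G x)^t* *m K (x, y) *m F y)).
  apply/funext => y; rewrite /kernel_op; case: ifPn => yl.
    rewrite adjmxD mulmxDl adjmxM trmxCK mulmxA; congr (_ + _).
    pose L x := (K (x, y))^t* *m G x.
    have iL : mx_cintegrable L.
      exact: (mx_cintegrable_bM (mx_bmeas_adj (bK2 y)) iG).
    rewrite -[X in (X^t*)]/(mxintegral setT L) (mxintegral_adj iL).
    rewrite -(mxintegralMr _ (mx_cintegrable_adj iL)).
    by congr mxintegral; apply/funext => x; rewrite adjmxM trmxCK.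
  rewrite (mx_sqint_out sF yl) !mulmx0 add0r.
  apply/matrixP => i j; rewrite !mxE -[LHS](Cintegral0 R).
  by congr Cintegral; apply/funext => x; rewrite !mulmx0 mxE.
have iH1 : mx_cintegrable
    (fun x => mxintegral setT (fun y => (G x)^t* *m K (x, y) *m F y)).
  move=> i j; under eq_fun do rewrite mxE.
  exact: (cintegrable_Cintegral (dH i j)).
have iH2 : mx_cintegrable
    (fun y => mxintegral setT (fun x => (G x)^t* *m K (x, y) *m F y)).
  move=> i j; under eq_fun do rewrite mxE.
  exact: (cintegrable_Cintegral (cdominated_swap (dH i j))).
rewrite E1 E2.
apply: (etrans (mxintegralD iGCF iH1)).
apply: (etrans _ (esym (mxintegralD iGCF iH2))).
exact: (congr1 (fun X => _ + X) (mxintegral_swap dH)).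
Qed.

End kernel_operator.

(** * Linearity, almost everywhere equality and L^2 bounds for kernel operators *)

Section kernel_operator_bounded.
Context (R : realType) (l : R).
Hypothesis l0 : 0 < l.
Notation mu := (@lebesgue_measure R).

Lemma mx_sqintZ m n (a : R[i]) (F : R -> 'M[R[i]]_(m, n)) :
  mx_sqint l F -> mx_sqint l (fun x => a *: F x).
Proof. by move=> sF i j; under eq_fun do rewrite mxE; exact: sqintZ. Qed.

Lemma kernel_op_linear m n (C : 'M[R[i]]_(m, n)) K a (F G : R -> 'cV[R[i]]_n) :
  mx_bmeas K -> mx_sqint l F -> mx_sqint l G ->
  kernel_op l C K (fun x => a *: F x + G x) =
  (fun x => a *: kernel_op l C K F x + kernel_op l C K G x).
Proof.
move=> bK sF sG; apply/funext => x; rewrite /kernel_op.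
case: ifPn => _; last by rewrite scaler0 addr0.
have iKF := mx_cintegrable_bM (mx_bmeas_pair1 x bK) (mx_sqint_cintegrable l0 sF).
have iKG := mx_cintegrable_bM (mx_bmeas_pair1 x bK) (mx_sqint_cintegrable l0 sG).
(* Scaling by [a] is written as multiplication by the matrix [a%:M], so that the rules for constant
   matrix factors apply. *)
have iaKF := mx_cintegrable_bM (mx_bmeas_cst R (a%:M : 'M[R[i]]_m)) iKF.
rewrite mulmxDr -scalemxAr scalerDr addrACA.
suff E : mxintegral setT (fun y => K (x, y) *m (a *: F y + G y)) =
    a *: mxintegral setT (fun y => K (x, y) *m F y) +
    mxintegral setT (fun y => K (x, y) *m G y) by rewrite E.
transitivity (mxintegral setT (fun y => a%:M *m (K (x, y) *m F y) + K (x, y) *m G y)).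
  congr mxintegral; apply/funext => y.
  by rewrite mulmxDr mul_scalar_mx -scalemxAr.
apply: (etrans (mxintegralD iaKF iKG)); rewrite -mul_scalar_mx.
exact: (congr1 (fun X => X + _) (mxintegralM _ iKF)).
Qed.

Lemma ae_imply (P Q : R -> Prop) : (forall x, P x -> Q x) ->
  {ae mu, forall x, P x} -> {ae mu, forall x, Q x}.
Proof. by move=> PQ; apply: filterS PQ; exact: (ae_filter_ringOfSetsType mu). Qed.

Lemma ae_eq_Cintegral (f g : R -> R[i]) : cmeas f -> cmeas g ->
  {ae mu, forall x, f x = g x} -> Cintegral setT f = Cintegral setT g.
Proof.
move=> [rf jf] [rg jg] fg.
have fgr : {ae mu, forall x, setT x -> (Re (f x))%:E = (Re (g x))%:E}.
  by move: fg; apply: ae_imply => x ->.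
have fgi : {ae mu, forall x, setT x -> (Im (f x))%:E = (Im (g x))%:E}.
  by move: fg; apply: ae_imply => x ->.
apply: complex_ext; congr fine.
  by apply: (ae_eq_integral _ _ _ _ _ fgr) => //; exact/measurable_EFinP.
by apply: (ae_eq_integral _ _ _ _ _ fgi) => //; exact/measurable_EFinP.
Qed.

(** The integral terms agree at every x, integration being blind to null sets; only the term C F(x)
    produces an exceptional set. *)
Lemma kernel_op_ae_eq m n (C : 'M[R[i]]_(m, n)) K (F G : R -> 'cV[R[i]]_n) :
  mx_bmeas K -> mx_sqint l F -> mx_sqint l G ->
  {ae mu, forall x, F x = G x} ->
  {ae mu, forall x, kernel_op l C K F x = kernel_op l C K G x}.
Proof.
move=> bK sF sG FG; move: (FG); apply: ae_imply => x Fx.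
rewrite /kernel_op Fx; case: ifPn => // _.
suff -> : mxintegral setT (fun y => K (x, y) *m F y) =
  mxintegral setT (fun y => K (x, y) *m G y) by [].
have iKF := mx_cintegrable_bM (mx_bmeas_pair1 x bK) (mx_sqint_cintegrable l0 sF).
have iKG := mx_cintegrable_bM (mx_bmeas_pair1 x bK) (mx_sqint_cintegrable l0 sG).
apply/matrixP => i j; rewrite !mxE; apply: ae_eq_Cintegral.
- exact: cintegrable_cmeas (iKF i j).
- exact: cintegrable_cmeas (iKG i j).
- by move: FG; apply: ae_imply => y ->.
Qed.

Lemma normsq_ge0 m (v : 'cV[R[i]]_m) : 0 <= normsq v.
Proof. by apply: sumr_ge0 => i _; exact: sqr_ge0. Qed.

Lemma normsqD m (v w : 'cV[R[i]]_m) : normsq (v + w) <= 2 * normsq v + 2 * normsq w.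
Proof.
rewrite /normsq !mulr_sumr -big_split/=; apply: ler_sum => i _.
by rewrite mxE; exact: normc_sqrD.
Qed.

Lemma normc_le_normsq m (v : 'cV[R[i]]_m) i : Normc.normc (v i 0) ^+ 2 <= normsq v.
Proof.
rewrite /normsq (bigD1 i)//= lerDl.
by apply: sumr_ge0 => j _; exact: sqr_ge0.
Qed.

Lemma normsq0 m : normsq (0 : 'cV[R[i]]_m) = 0.
Proof. by rewrite /normsq big1// => i _; rewrite mxE Normc.normc0 expr0n. Qed.

Lemma integrable_normsq m (F : R -> 'cV[R[i]]_m) : mx_sqint l F ->
  mu.-integrable setT (EFin \o (fun x => normsq (F x))).
Proof.
move=> sF; rewrite (_ : _ \o _ =
   fun x => (\sum_(i < m) (Normc.normc (F x i 0) ^+ 2)%:E)%E).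
  by apply: integrable_sum => // i _; have [] := sF i 0.
by apply/funext => x; rewrite /= sumEFin.
Qed.

Definition sqnorm m (F : R -> 'cV[R[i]]_m) : R := \int[mu]_x normsq (F x).

Lemma sqnorm_ge0 m (F : R -> 'cV[R[i]]_m) : 0 <= sqnorm F.
Proof. by apply: Rintegral_ge0 => x _; exact: normsq_ge0. Qed.

(** [phi F] is one scalar component of an operator applied to F. The local term [normsq (F x)]
    controls multiplication by a constant; an integral term is controlled only by the norm of F, and
    the cut-off to ]0, l[ keeps that constant integrable. The form is stable under finite sums. *)
Definition quadratic_bound n (phi : (R -> 'cV[R[i]]_n) -> R -> R[i]) : Prop :=
  exists2 c, 0 <= c & forall F, mx_sqint l F -> forall x,
    Normc.normc (phi F x) ^+ 2 <=
    c * (normsq (F x) + if x \in `]0, l[ then sqnorm F else 0).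

Lemma quadratic_boundD n (phi psi : (R -> 'cV[R[i]]_n) -> R -> R[i]) :
  quadratic_bound phi -> quadratic_bound psi ->
  quadratic_bound (fun F x => phi F x + psi F x).
Proof.
move=> [c c0 hc] [d d0 hd]; exists (2 * c + 2 * d).
  by rewrite addr_ge0// mulr_ge0.
move=> F sF x; apply: (le_trans (normc_sqrD _ _)).
by have := hc F sF x; have := hd F sF x; lra.
Qed.

Lemma quadratic_bound_sum n (I : Type) (r : seq I)
    (phi : I -> (R -> 'cV[R[i]]_n) -> R -> R[i]) :
  (forall i, quadratic_bound (phi i)) ->
  quadratic_bound (fun F x => \sum_(i <- r) phi i F x).
Proof.
move=> h; elim: r => [|i r [c c0 hc]].
  exists 0 => // F _ x; rewrite big_nil Normc.normc0 expr0n mul0r//.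
have [d d0 hd] := quadratic_boundD (h i) (ex_intro2 _ _ c c0 hc).
by exists d => // F sF x; rewrite big_cons; exact: hd.
Qed.

Lemma quadratic_bound_entry n (c : R[i]) k :
  quadratic_bound (fun (F : R -> 'cV[R[i]]_n) x => c * F x k 0).
Proof.
exists (Normc.normc c ^+ 2); first exact: sqr_ge0.
move=> F sF x; rewrite Normc.normcM exprMn ler_wpM2l ?sqr_ge0//.
apply: (le_trans (normc_le_normsq _ _)); rewrite lerDl.
by case: ifP => // _; exact: sqnorm_ge0.
Qed.

(** In the constant, 2 (2 M)^2 comes from [le_Cintegral_kernel] and [normc_sqr_le], and 2 l from the
    Cauchy-Schwarz estimate [sqr_Rintegral_norm1]. *)
Lemma quadratic_bound_kernel n (k : R * R -> R[i]) a : cmeas k -> cbounded k ->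
  quadratic_bound (fun (F : R -> 'cV[R[i]]_n) x =>
    if x \in `]0, l[ then Cintegral setT (fun y => k (x, y) * F y a 0) else 0).
Proof.
move=> mk [M bk]; have c0 : 0 <= 2 * (M + M) ^+ 2 * (2 * l).
  by apply: mulr_ge0; apply: mulr_ge0 => //; [exact: sqr_ge0|exact: ltW].
exists (2 * (M + M) ^+ 2 * (2 * l)) => //.
move=> F sF x; case: ifPn => _; last first.
  by rewrite Normc.normc0 expr0n addr0/= mulr_ge0 ?normsq_ge0.
have sFa := sF a 0.
have [h1 h2] := le_Cintegral_kernel x mk bk (sqint_cintegrable l0 sFa).
apply: (le_trans (normc_sqr_le h1 h2)).
rewrite exprMn (mulrA 2) -[X in _ <= X]mulrA; apply: ler_wpM2l.
  by rewrite mulr_ge0 ?sqr_ge0.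
apply: (le_trans (sqr_Rintegral_norm1 l0 sFa)).
rewrite ler_wpM2l ?mulr_ge0//; first exact: ltW.
apply: (@le_trans _ _ (sqnorm F)); last by rewrite lerDr normsq_ge0.
apply: le_Rintegral => //; first by case: sFa.
  exact: integrable_normsq.
by move=> y _; exact: normc_le_normsq.
Qed.

Lemma kernel_op_sqnorm m n (C : 'M[R[i]]_(m, n)) K : mx_bmeas K ->
  exists2 c, 0 <= c & forall F, mx_sqint l F ->
    sqnorm (kernel_op l C K F) <= c * sqnorm F.
Proof.
move=> bK.
have h i : quadratic_bound (fun F x => \sum_k (C i k * F x k 0 +
     (if x \in `]0, l[ then Cintegral setT (fun y => K (x, y) i k * F y k 0) else 0))).
  apply: quadratic_bound_sum => k; apply: quadratic_boundD.
    exact: quadratic_bound_entry.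
  by have [mK bdK] := bK i k; exact: (quadratic_bound_kernel _ mK bdK).
have [c hc] := choice (fun i =>
  let: ex_intro2 c c0 hc := h i in ex_intro _ c (conj c0 hc)).
(* Row i contributes [c i]. In the last factor, 1 comes from integrating the local term and l from
   integrating the constant [sqnorm F] over ]0, l[. *)
exists ((\sum_i c i) * (1 + l)).
  apply: mulr_ge0; last by rewrite addr_ge0// ltW.
  by apply: sumr_ge0 => i _; have [] := hc i.
move=> F sF.
have i1 := integrable_normsq sF.
have i2 := integrable_step l0 (sqnorm F).
apply: (@le_trans _ _ (\int[mu]_x ((\sum_i c i) * (normsq (F x) +
    (if x \in `]0, l[ then sqnorm F else 0))))).
  apply: le_Rintegral => //.
  - by apply: integrable_normsq; exact: kernel_op_sqint.
  - exact: (integrableZl measurableT _ (integrableD measurableT i1 i2)).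
  - move=> x _; rewrite mulr_suml; apply: ler_sum => i _.
    have [_ hi] := hc i.
    by have := congr1 (@^~ x) (kernel_opE l0 C i 0 bK sF) => /= ->; exact: hi.
rewrite (RintegralZl _ measurableT (integrableD measurableT i1 i2)).
rewrite (RintegralD measurableT i1 i2) Rintegral_step// -/(sqnorm F).
by rewrite -mulrA mulrDl mul1r [l * _]mulrC.
Qed.

End kernel_operator_bounded.

(** * Functions on an interval *)

Section derivative.
Context (R : realType) (l : R).

(** At an interior point all small increments stay in [0, l], so the restriction on h disappears
    near 0. *)
Lemma has_derivative_within_cvg (phi : R -> R) x d : x \in `]0, l[ ->
  has_derivative_within `[0, l] phi x d ->
  (fun h => h^-1 * (phi (x + h) - phi x)) @ 0^' --> d.
Proof.
move=> xl hd.
have near0 : \forall h \near (0 : R)^', `[0, l]%classic (x + h).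
  rewrite near_withinE/=; have xo : \forall y \near x, y \in `]0, l[.
    exact: near_in_itvoo.
  have : \forall h \near (0 : R), x + h \in `]0, l[.
    have cx : (fun h => x + h) @ (0 : R) --> x.
      by rewrite -{2}[x]addr0; apply: cvgD; [exact: cvg_cst|exact: cvg_id].
    exact: cx xo.
  apply: filterS => h xh _ /=.
  by apply: subset_itv_oo_cc.
move=> A /hd; rewrite /= /nbhs/= => hA.
by apply: filterS2 near0 hA => h Dh /(_ Dh).
Qed.

(** The difference quotients with increments 1/(n+1) converge pointwise to the derivative, and they
    are measurable because a differentiable function is continuous on the open interval. *)
Lemma measurable_derivative_within (phi dphi : R -> R) :
  (forall x, `[0, l]%classic x -> has_derivative_within `[0, l] phi x (dphi x)) ->
  measurable_fun `]0, l[ dphi.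
Proof.
move=> hd.
have hc x : x \in `]0, l[ ->
    (fun h => h^-1 * (phi (x + h) - phi x)) @ 0^' --> dphi x.
  by move=> xl; apply: has_derivative_within_cvg => //; apply: hd;
    exact: subset_itv_oo_cc.
have mphi : measurable_fun `]0, l[ phi.
  apply: open_continuous_measurable_fun; first exact: interval_open.
  move=> x /[!inE] xl; apply: differentiable_continuous.
  apply/derivable1_diffP; apply/cvg_ex; exists (dphi x).
  have := hc x xl; apply: cvg_trans; apply: near_eq_cvg.
  by near=> h; rewrite /= -[h%:A]/(h * 1) mulr1 [h + x]addrC.
have mphit : measurable_fun setT (phi \_ `]0, l[).
  exact: (iffLR (measurable_restrictT phi (measurable_itv `]0, l[)) mphi).
(* Extending phi by 0 makes each quotient a measurable function on the whole line. For fixed x in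
   ]0, l[ the point x + 1/(n+1) is eventually inside, so the limit is unaffected. *)
pose q (n : nat) (x : R) : R := n.+1%:R *
  ((phi \_ `]0, l[) (x + harmonic n) - (phi \_ `]0, l[) x).
apply: (@measurable_fun_cvg _ _ R _ q) => [n|x xl].
  apply: (measurable_funS measurableT) => //.
  apply: measurable_funM => //; apply: measurable_funB => //.
  apply: (measurableT_comp mphit); exact: measurable_funD.
have hx := hc x xl.
have h0 : harmonic n @[n --> \oo] --> (0 : R)^'.
  move=> A A0.
  have : \forall n \near \oo, harmonic n != 0 :> R -> A (harmonic n).
    exact: (@cvg_harmonic R _ A0).
  by apply: filterS => n /=; apply; rewrite invr_eq0 pnatr_eq0.
have := cvg_comp _ _ h0 hx; apply: cvg_trans; apply: near_eq_cvg.
have xo : \forall y \near x, y \in `]0, l[ by exact: near_in_itvoo.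
have cx : x + harmonic n @[n --> \oo] --> x.
  by rewrite -{2}[x]addr0; apply: cvgD; [exact: cvg_cst|exact: cvg_harmonic].
have : \forall n \near \oo, x + harmonic n \in `]0, l[ by exact: (cx _ xo).
apply: filterS => n /= xn; rewrite /q !patchE !mem_setE xn invrK.
by move: xl => /= ->.
Unshelve. all: by end_near.
Qed.

End derivative.

(** * Extension by zero: from functions on the interval to functions on the line *)

Definition cutoff (R : realType) (l : R) m n (F : R -> 'M[R[i]]_(m, n)) (x : R) :
    'M[R[i]]_(m, n) :=
  if x \in `]0, l[ then F x else 0.

Section cutoff.
Context (R : realType) (l : R).
Notation mu := (@lebesgue_measure R).

Lemma cutoff_entry m n (F : R -> 'M[R[i]]_(m, n)) i j :
  (fun x => cutoff l F x i j) = (fun x => if x \in `]0, l[ then F x i j else 0).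
Proof. by apply/funext => x; rewrite /cutoff; case: ifP => // _; rewrite mxE. Qed.

Lemma Cintegral_mkcond (f : R -> R[i]) (i : interval R) :
  Cintegral [set` i] f = Cintegral setT (fun x => if x \in i then f x else 0).
Proof.
apply: complex_ext => /=; rewrite Rintegral_mkcond -if_itv_patch;
  by apply: eq_Rintegral => x _; case: ifP.
Qed.

Lemma mxintegral_cutoff m n (F : R -> 'M[R[i]]_(m, n)) :
  mxintegral `]0, l[ F = mxintegral setT (cutoff l F).
Proof. by apply/matrixP => i j; rewrite !mxE Cintegral_mkcond cutoff_entry. Qed.

(** [dotL2] is linear in its first argument, hence the adjoint of g stands on the left of the matrix
    product. *)
Lemma dotL2E m (f g : R -> 'cV[R[i]]_m) :
  dotL2 l f g = mxintegral setT (fun x => (cutoff l g x)^t* *m cutoff l f x) 0 0.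
Proof.
rewrite /dotL2 Cintegral_mkcond mxE; congr Cintegral; apply/funext => x.
rewrite /cutoff; case: ifP => _; last by rewrite mulmx0 mxE.
by rewrite mxE; apply: eq_bigr => i _; rewrite !mxE mulrC.
Qed.

Lemma normL2E m (f : R -> 'cV[R[i]]_m) : normL2 l f = Num.sqrt (sqnorm (cutoff l f)).
Proof.
congr Num.sqrt; rewrite Rintegral_mkcond -if_itv_patch; apply: eq_Rintegral => x _.
by rewrite /cutoff; case: ifP => // _; rewrite normsq0.
Qed.

Lemma measurable_cutoff (h : R -> R) : measurable_fun `]0, l[ h <->
  measurable_fun [set: R] (fun x => if x \in `]0, l[ then h x else 0).
Proof. by rewrite if_itv_patch; exact: measurable_restrictT. Qed.

Lemma L2_cutoff m (f : R -> 'cV[R[i]]_m) : L2 l f -> mx_sqint l (cutoff l f).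
Proof.
move=> [mf fi] i j; rewrite (ord1 j) cutoff_entry; have [rf jf] := mf i.
have mc : cmeas (fun x => if x \in `]0, l[ then f x i 0 else 0).
  split; [move/measurable_cutoff : rf|move/measurable_cutoff : jf];
    by apply: eq_measurable_fun => x _; case: ifP.
apply: (@le_sqint _ _ _ (fun x => if x \in `]0, l[ then normsq (f x) else 0)) => //.
- by move=> x /negbTE ->.
- move=> x; case: ifP => _; first exact: normc_le_normsq.
  by rewrite Normc.normc0 expr0n.
- rewrite if_itv_patch -restrict_EFin; apply/integrable_restrict => //.
  rewrite setTI; apply/integrableP; split.
    apply/measurable_EFinP.
    have -> : (fun x => normsq (f x)) =
        (fun x => \sum_(k < m) (Re (f x k 0) ^+ 2 + Im (f x k 0) ^+ 2)).
      by apply/funext => x; apply: eq_bigr => k _; rewrite normc_sqr.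
    apply: measurable_sum => k.
    by have [? ?] := mf k; apply: measurable_funD; exact: measurable_funX.
  under eq_integral do rewrite /= ger0_norm ?normsq_ge0//.
  exact: fi.
Qed.

Lemma sqint_L2 m (F g : R -> 'cV[R[i]]_m) : mx_sqint l F ->
  (forall x, x \in `]0, l[ -> g x = F x) -> L2 l g.
Proof.
move=> sF gF; split.
  move=> i; have [[rF jF] _ _] := sF i 0; split.
    apply: (eq_measurable_fun (fun x => Re (F x i 0))).
      by move=> x /[!inE] xl; rewrite gF.
    exact: measurable_funTS.
  apply: (eq_measurable_fun (fun x => Im (F x i 0))).
    by move=> x /[!inE] xl; rewrite gF.
  exact: measurable_funTS.
have /integrableP[_ fin] := integrable_normsq sF.
rewrite integral_mkcond; apply: le_lt_trans fin; rewrite le_eqVlt; apply/orP; left.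
apply/eqP; apply: eq_integral => x _.
rewrite /= ger0_norm ?normsq_ge0// patchE mem_setE.
by case: ifPn => [/gF->//|xl]; rewrite (mx_sqint_out sF xl) normsq0.
Qed.

Lemma cutoff_bmeas m n (F dF : R -> 'M[R[i]]_(m, n)) :
  boundedly_differentiable l F dF -> mx_bmeas (cutoff l dF).
Proof.
move=> [hd [M bM]] i j; rewrite cutoff_entry; split.
  split.
    have /measurable_cutoff : measurable_fun `]0, l[ (fun x => Re (dF x i j)).
      by apply: (measurable_derivative_within (phi := fun x => Re (F x i j))) => x xl;
        have [] := hd x xl i j.
    by apply: eq_measurable_fun => x _; case: ifP.
  have /measurable_cutoff : measurable_fun `]0, l[ (fun x => Im (dF x i j)).
    by apply: (measurable_derivative_within (phi := fun x => Im (F x i j))) => x xl;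
      have [] := hd x xl i j.
  by apply: eq_measurable_fun => x _; case: ifP.
(* The absolute value makes the bound valid off the interval too, where the function is 0. *)
exists `|M| => x; case: ifPn => xl; last by rewrite normr0.
have bx : Normc.normc (dF x i j) <= `|M|.
  apply: (le_trans (bM x _ i j)); last exact: ler_norm.
  exact: subset_itv_oo_cc.
have b2 : Re (dF x i j) ^+ 2 + Im (dF x i j) ^+ 2 <= `|M| ^+ 2.
  rewrite -normc_sqr lerXn2r// nnegrE//.
  by case: (dF x i j) => a b; exact: sqrtr_ge0.
by split; rewrite -ler_sqr ?nnegrE// real_normK ?num_real//;
  apply: le_trans b2; rewrite ?lerDl ?lerDr sqr_ge0.
Qed.

Lemma Rintegral_itv_oo_cc (a b : R) (h : R -> R) : measurable_fun `]a, b[ h ->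
  \int[mu]_(x in `[a, b]) h x = \int[mu]_(x in `]a, b[) h x.
Proof.
move=> mh; rewrite /Rintegral; congr fine.
rewrite integral_itv_bndo_bndc; last exact/measurable_EFinP.
rewrite integral_itv_obnd_cbnd//; apply/measurable_EFinP.
exact/measurable_fun_itv_bndo_bndcP.
Qed.

(** The integral in [s_kernel] runs over a closed interval, while D is cut off to an open one. The
    integrands may differ at the two end points, a null set; inside, g inherits its measurability
    from h. *)
Lemma Cintegral_itv_cc (a b : R) (g h : R -> R[i]) : cmeas h ->
  (forall x, x \in `]a, b[ -> g x = h x) ->
  (forall x, x \notin `]a, b[ -> h x = 0) ->
  Cintegral `[a, b] g = Cintegral setT h.
Proof.
move=> [rh jh] gh h0; apply: complex_ext => /=.
  rewrite Rintegral_itv_oo_cc; last first.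
    apply: (eq_measurable_fun (fun x => Re (h x))); last exact: measurable_funTS.
    by move=> x /[!inE] xl; rewrite gh.
  rewrite Rintegral_mkcond -if_itv_patch; apply: eq_Rintegral => x _.
  by case: ifPn => [/gh->|/h0->].
rewrite Rintegral_itv_oo_cc; last first.
  apply: (eq_measurable_fun (fun x => Im (h x))); last exact: measurable_funTS.
  by move=> x /[!inE] xl; rewrite gh.
rewrite Rintegral_mkcond -if_itv_patch; apply: eq_Rintegral => x _.
by case: ifPn => [/gh->|/h0->].
Qed.

End cutoff.

(** * The operator S *)

Lemma conjC_add (R : rcfType) (z w : R[i]) : (z + w)^* = z^* + w^*.
Proof.
by apply: complex_ext; rewrite !(Re_conjC, Im_conjC, Re_add, Im_add) ?opprD.
Qed.

(** * Hermitian symmetry and positivity of the integrated form *)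

Section hermitian_forms.
Context (R : realType) (l : R).
Notation mu := (@lebesgue_measure R).

Lemma mxintegral_adj_mul m (F G : R -> 'cV[R[i]]_m) : mx_sqint l F -> mx_sqint l G ->
  mxintegral setT (fun x => (F x)^t* *m G x) 0 0 =
  (mxintegral setT (fun x => (G x)^t* *m F x) 0 0)^*.
Proof.
move=> sF sG.
have i1 := mx_sqintM (mx_sqint_adj sG) sF.
have := congr1 (fun A : 'M[R[i]]_1 => A 0 0) (mxintegral_adj i1).
rewrite [LHS]mxE [X in X^*]mxE => ->; rewrite [LHS]mxE [RHS]mxE.
by congr Cintegral; apply/funext => x; rewrite adjmxM trmxCK.
Qed.

Lemma mxintegral_adj_ge0 m (F : R -> 'cV[R[i]]_m) :
  0 <= mxintegral setT (fun x => (F x)^t* *m F x) 0 0.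
Proof.
have E x : ((F x)^t* *m F x) 0 0 = (normsq (F x))%:C.
  rewrite mxE /normsq rmorph_sum/=; apply: eq_bigr => i _; rewrite !mxE.
  apply: complex_ext; rewrite ?Re_mul ?Im_mul Re_conjC Im_conjC /= ?normc_sqr; ring.
rewrite mxE lecE /=; apply/andP; split.
  (* The order on R[i] also asks for equal imaginary parts; here the imaginary part is the integral
     of the constant 0. *)
  apply/eqP; rewrite -[RHS](mul0r (fine (mu setT))) -Rintegral_cst//.
  by apply: eq_Rintegral => x _; rewrite E.
by apply: Rintegral_ge0 => x _; rewrite E /= normsq_ge0.
Qed.

End hermitian_forms.

Lemma op_le_id_scale1 (R : realType) (l : R) m
    (T : (R -> 'cV[R[i]]_m) -> (R -> 'cV[R[i]]_m)) :
  op_le l (fun f => f) T -> strictly_positive l T.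
Proof.
move=> h; exists 1; first exact: ltr01.
rewrite (_ : (fun _ => _) = (fun f => f))//.
by apply/funext => f; apply/funext => x; rewrite scale1r.
Qed.

Section S_operator.
Context (R : realType) (l : R) (l0 : 0 < l) (m1 m2 : nat).
Variables Phi dPhi : R -> 'M[R[i]]_(m2, m1).
Hypothesis bD : mx_bmeas (cutoff l dPhi).

Notation mu := (@lebesgue_measure R).
Let S := S_op l Phi dPhi.
Let D := cutoff l dPhi.
Let K (z : R * R) := D (z.1 - z.2).
Let V := kernel_op l (Phi 0) K.
Let W := kernel_op l ((Phi 0)^t*) (fun z => (K (z.2, z.1))^t*).

Let bK : mx_bmeas K.
Proof.
apply: (mx_bmeas_comp bD); apply: measurable_funB; first exact: measurable_fst.
exact: measurable_snd.
Qed.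

Let bK' : mx_bmeas (fun z => (K (z.2, z.1))^t*).
Proof. by apply: mx_bmeas_adj; exact: mx_bmeas_swap. Qed.

(** As a function of z, D(x - z) may be nonzero for z <= 0. The cut-off restores the lower limit 0
    of the integral in s. *)
Let Dx x := cutoff l (fun z => D (x - z)).

Let bDx x : mx_bmeas (Dx x).
Proof.
move=> i j; have [mK bdK] := mx_bmeas_pair1 x bK i j.
rewrite cutoff_entry; split; last exact: cbounded_if.
by apply: cmeas_if => //; exact: measurable_mem_itv.
Qed.

Let sDx x : mx_sqint l (Dx x).
Proof.
move=> i j; have [mK bdK] := bDx x i j.
by apply: bounded_sqint => // z zl; rewrite /Dx /cutoff (negbTE zl) mxE.
Qed.

(** The factors D(x - z) and D(t - z) both survive only for z < min(x, t), and [Dx] forces z > 0. In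
    the case term, D(x - t) or D(t - x) vanishes by sign; for x = t both do, since 0 is not in ]0,
    l[, in agreement with the value 0 on the diagonal. *)
Lemma s_kernelE x t : x \in `]0, l[ -> t \in `]0, l[ ->
  s_kernel Phi dPhi x t =
  mxintegral setT (fun z => Dx x z *m (D (t - z))^t*) +
  (D (x - t) *m (Phi 0)^t* + Phi 0 *m (D (t - x))^t*).
Proof.
move=> xl tl; rewrite /s_kernel; apply: (f_equal2 +%R).
  apply/matrixP => i j; rewrite [LHS]mxE [RHS]mxE.
  apply: (@Cintegral_itv_cc _ _ _
    (fun z => (dPhi (x - z) *m (dPhi (t - z))^t*) i j)
    (fun z => (Dx x z *m (D (t - z))^t*) i j)).
  - apply: cintegrable_cmeas.
    apply: (mx_cintegrable_Mb (mx_sqint_cintegrable l0 (sDx x))).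
    exact: (mx_bmeas_adj (mx_bmeas_pair1 t bK)).
  - move=> z; rewrite !in_itv/= lt_min => /and3P[z0 zx zt].
    move: xl tl; rewrite !in_itv/= => /andP[x0 xl] /andP[t0 tl].
    rewrite /Dx /D /cutoff !in_itv/=.
    by rewrite !ifT//; lra.
  - move=> z; rewrite !in_itv/= lt_min => zn.
    rewrite /Dx /D /cutoff !in_itv/=.
    case: ifPn => [/andP[z0 zl]|_]; last by rewrite mul0mx mxE.
    case: ifPn => [/andP[xz _]|_]; last by rewrite mul0mx mxE.
    case: ifPn => [/andP[tz _]|_]; last by rewrite trmx0 map_mx0 mulmx0 mxE.
    by exfalso; move: zn; rewrite -(subr_gt0 z x) -(subr_gt0 z t) xz tz z0.
move: xl tl; rewrite !in_itv/= => /andP[x0 xl] /andP[t0 tl].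
rewrite /D /cutoff !in_itv/=.
have [tx|xt|->] := ltgtP t x.
- by rewrite ifT ?ifF; [rewrite trmx0 map_mx0 mulmx0 addr0|apply/negbTE; lra|lra].
- by rewrite ifF ?ifT; [rewrite mul0mx add0r|lra|apply/negbTE; lra].
- by rewrite subrr ltxx/= mul0mx trmx0 map_mx0 mulmx0 addr0.
Qed.

(** By [s_kernelE], s(x, t) F(t) splits into the z-integral of H(z, t) and the terms Q(t) and Phi(0)
    T(t). Expanding V (W F) at x gives the same pieces with the integrals of H in the opposite
    order, together with Phi(0) Phi(0)^* F(x). *)
Lemma S_opE (f : R -> 'cV[R[i]]_m2) x : mx_sqint l (cutoff l f) -> x \in `]0, l[ ->
  S_op l Phi dPhi f x = cutoff l f x + V (W (cutoff l f)) x.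
Proof.
set F := cutoff l f => sF xl.
have iF := mx_sqint_cintegrable l0 sF.
have iDx := mx_sqint_cintegrable l0 (sDx x).
(* The first variable is the intermediate one of the composition, the second that of F. Domination
   comes from the integrable outer factors [Dx x] and F around the bounded kernel D. *)
pose H (w : R * R) := Dx x w.1 *m (D (w.2 - w.1))^t* *m F w.2.
have dH : mx_cdominated H := mx_cdominatedM iDx bK' iF.
have iH2 : mx_cintegrable (fun t => mxintegral setT (fun z => H (z, t))).
  move=> i j; under eq_fun do rewrite mxE.
  exact: (cintegrable_Cintegral (cdominated_swap (dH i j))).
have iH1 : mx_cintegrable (fun z => mxintegral setT (fun t => H (z, t))).
  move=> i j; under eq_fun do rewrite mxE.
  exact: (cintegrable_Cintegral (dH i j)).
pose Q t := Dx x t *m ((Phi 0)^t* *m F t).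
have iQ : mx_cintegrable Q.
  apply: (mx_cintegrable_bM (bDx x)); apply: mx_cintegrable_bM => //.
  exact: mx_bmeas_cst.
pose T t := (D (t - x))^t* *m F t.
have iT : mx_cintegrable T := mx_cintegrable_bM (mx_bmeas_pair1 x bK') iF.
have iAT : mx_cintegrable (fun t => Phi 0 *m T t).
  by apply: mx_cintegrable_bM => //; exact: mx_bmeas_cst.
have iDs t : mx_cintegrable (fun z => Dx x z *m (D (t - z))^t*).
  exact: (mx_cintegrable_Mb iDx (mx_bmeas_adj (mx_bmeas_pair1 t bK))).
have E1 : mxintegral `]0, l[ (fun t => s_kernel Phi dPhi x t *m f t) =
    mxintegral setT (fun t => mxintegral setT (fun z => H (z, t)) +
      (Q t + Phi 0 *m T t)).
  rewrite mxintegral_cutoff; congr mxintegral; apply/funext => t.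
  have [tl|tl] := boolP (t \in `]0, l[); last first.
    rewrite {1}/cutoff (negbTE tl) /Q /T (mx_sqint_out sF tl) !mulmx0 !addr0.
    apply/matrixP => i j; rewrite mxE [RHS]mxE -[LHS](Cintegral0 R).
    by congr Cintegral; apply/funext => z; rewrite /H/= (mx_sqint_out sF tl) mulmx0 mxE.
  rewrite {1}/cutoff tl s_kernelE// mulmxDl.
  have -> : f t = F t by rewrite /F /cutoff tl.
  rewrite -(mxintegralMr _ (iDs t)).
  rewrite mulmxDl -!mulmxA /Q /T.
  by rewrite /Dx [in X in _ = _ + (X + _)]/cutoff tl.
rewrite /S_op E1 {E1}.
have iQT := mx_cintegrableD iQ iAT.
have -> : mxintegral setT (fun t => mxintegral setT (fun z => H (z, t)) +
      (Q t + Phi 0 *m T t)) =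
  mxintegral setT (fun z => mxintegral setT (fun t => H (z, t))) +
    (mxintegral setT Q + Phi 0 *m mxintegral setT T).
  apply: (etrans (mxintegralD iH2 iQT)).
  apply: (f_equal2 +%R (esym (mxintegral_swap dH))).
  apply: (etrans (mxintegralD iQ iAT)).
  exact: (congr1 (fun X => _ + X) (mxintegralM _ iT)).
have -> : V (W F) x = Phi 0 *m ((Phi 0)^t* *m F x + mxintegral setT T) +
    (mxintegral setT Q + mxintegral setT (fun z => mxintegral setT (fun t => H (z, t)))).
  rewrite /V {1}/kernel_op xl {1}/W {1}/kernel_op xl.
  apply: (congr1 (fun X => _ + X)).
  apply: (etrans _ (mxintegralD iQ iH1)).
  congr mxintegral; apply/funext => z.
  rewrite /W /kernel_op /Q /Dx /cutoff -/(cutoff l dPhi).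
  (* Off ]0, l[ both sides are 0: W F by its cut-off, Q and H by that of [Dx]. *)
  case: ifPn => zl; last first.
    rewrite mulmx0 !mul0mx add0r; apply/esym.
    apply/matrixP => i j; rewrite mxE [RHS]mxE -[RHS](Cintegral0 R).
    by congr Cintegral; apply/funext => t; rewrite /H /Dx /cutoff/= (negbTE zl) !mul0mx mxE.
  rewrite mulmxDr; apply: (congr1 (fun X => _ + X)).
  rewrite -(mxintegralM _ (mx_cintegrable_bM (mx_bmeas_pair1 z bK') iF)).
  congr mxintegral; apply/funext => t.
  by rewrite /H /Dx [in RHS]/cutoff/= zl mulmxA.
have -> : f x = F x by rewrite /F /cutoff xl.
rewrite mulmxDl mul1mx -addrA mulmxDr !mulmxA -!addrA; congr (_ + (_ + _)).
by rewrite [LHS]addrC -!addrA addrCA addrA.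
Qed.

Let sW F : mx_sqint l F -> mx_sqint l (W F).
Proof. exact: kernel_op_sqint. Qed.

Let sVW F : mx_sqint l F -> mx_sqint l (V (W F)).
Proof. by move=> sF; apply: kernel_op_sqint => //; exact: sW. Qed.

Let S_E f x : mx_sqint l (cutoff l f) -> x \in `]0, l[ ->
  S f x = cutoff l f x + V (W (cutoff l f)) x.
Proof. exact: S_opE. Qed.

Let cutoff_S f : mx_sqint l (cutoff l f) ->
  cutoff l (S f) = (fun x => cutoff l f x + V (W (cutoff l f)) x).
Proof.
move=> sf; apply/funext => x; rewrite {1}/cutoff; case: ifPn => xl.
  exact: S_opE.
by rewrite (mx_sqint_out (mx_sqintD sf (sVW sf)) xl).
Qed.

(** [kernel_op_adj] is applied to V acting on W f; the adjoint operator that it produces on g is W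
    by definition. *)
Lemma dotL2_S f g : mx_sqint l (cutoff l f) -> mx_sqint l (cutoff l g) ->
  dotL2 l (S f) g = dotL2 l f g +
    mxintegral setT (fun x => (W (cutoff l g) x)^t* *m W (cutoff l f) x) 0 0.
Proof.
move=> sf sg; rewrite !dotL2E.
have ga := mx_sqint_adj sg.
transitivity (mxintegral setT (fun x => (cutoff l g x)^t* *m cutoff l f x +
   (cutoff l g x)^t* *m V (W (cutoff l f)) x) 0 0).
  apply: (congr1 (fun F => mxintegral setT F 0 0)); apply/funext => x.
  by rewrite (cutoff_S sf) mulmxDr.
have E := mxintegralD (mx_sqintM ga sf) (mx_sqintM ga (sVW sf)).
apply: (etrans (congr1 (fun A : 'M[R[i]]_1 => A 0 0) E)); rewrite [LHS]mxE.
apply: (congr1 (fun X => _ + X)).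
exact: (congr1 (fun A : 'M[R[i]]_1 => A 0 0) (kernel_op_adj l0 (Phi 0) bK (sW sf) sg)).
Qed.

Lemma S_ge_id : op_le l (fun f => f) S.
Proof.
have conjE (f g : R -> 'cV[R[i]]_m2) :
      mx_sqint l (cutoff l f) -> mx_sqint l (cutoff l g) ->
    dotL2 l f g = (dotL2 l g f)^*.
  by move=> sf sg; rewrite !dotL2E; exact: mxintegral_adj_mul.
split=> [//|f g /L2_cutoff sf /L2_cutoff sg|f /L2_cutoff sf].
  have sSg : mx_sqint l (cutoff l (S g)).
    by rewrite cutoff_S//; exact: mx_sqintD sg (sVW sg).
  (* Conjugation brings S into the first slot on both sides, where [dotL2_S] applies; each of the
     two resulting forms is Hermitian. *)
  rewrite (conjE f (S g) sf sSg) !dotL2_S//.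
  apply: (etrans (f_equal2 +%R (conjE f g sf sg)
    (mxintegral_adj_mul (sW sg) (sW sf)))).
  exact: (esym (conjC_add _ _)).
by rewrite dotL2_S// lerDl mxintegral_adj_ge0.
Qed.

(** Each clause is carried through W, then V, by the factorization. *)
Lemma S_bounded : bounded_operator l S.
Proof.
split.
- move=> f /L2_cutoff sf; apply: (sqint_L2 (mx_sqintD sf (sVW sf))) => x xl.
  exact: S_opE.
- move=> f g /L2_cutoff sf /L2_cutoff sg fg.
  have cfg : {ae mu, forall x, cutoff l f x = cutoff l g x}.
    by move: fg; apply: ae_imply => x; rewrite /cutoff; case: ifP => // xl ->.
  have Wfg := kernel_op_ae_eq l0 ((Phi 0)^t*) bK' sf sg cfg.
  have Vfg := kernel_op_ae_eq l0 (Phi 0) bK (sW sf) (sW sg) Wfg.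
  have F := ae_filter_ringOfSetsType mu.
  apply: (@filterS2 _ _ F _ _ _ _ cfg Vfg) => x h1 h2 xl.
  exact: (etrans (S_E sf xl) (etrans (f_equal2 +%R h1 h2) (esym (S_E sg xl)))).
- move=> a f g /L2_cutoff sf /L2_cutoff sg.
  have E : cutoff l (fun x => a *: f x + g x) =
      (fun x => a *: cutoff l f x + cutoff l g x).
    apply/funext => x; rewrite /cutoff; case: ifP => // _.
    by rewrite scaler0 addr0.
  have safg : mx_sqint l (cutoff l (fun x => a *: f x + g x)).
    by rewrite E; apply: mx_sqintD => //; exact: mx_sqintZ.
  have EW := kernel_op_linear l0 ((Phi 0)^t*) a bK' sf sg.
  have EV := kernel_op_linear l0 (Phi 0) a bK (sW sf) (sW sg).
  apply/aeW => x xl; rewrite (S_E safg xl) (S_E sf xl) (S_E sg xl).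
  rewrite E /W EW /V EV scalerDr; exact: addrACA.
- have [c c0 hc] := kernel_op_sqnorm l0 ((Phi 0)^t*) bK'.
  have [d d0 hd] := kernel_op_sqnorm l0 (Phi 0) bK.
  (* The squared norm of F + V W F is at most twice that of F plus twice that of V W F; c and d are
     the squared bounds for W and V. *)
  exists (Num.sqrt (2 + 2 * (d * c))) => f /L2_cutoff sf.
  rewrite !normL2E -sqrtrM; last by rewrite addr_ge0// mulr_ge0// mulr_ge0.
  apply: ler_wsqrtr; rewrite cutoff_S//.
  have i1 := integrable_normsq sf; have i2 := integrable_normsq (sVW sf).
  have i12 := integrableD measurableT (integrableZl measurableT 2 i1)
    (integrableZl measurableT 2 i2).
  apply: (@le_trans _ _ (2 * sqnorm (cutoff l f) + 2 * sqnorm (V (W (cutoff l f))))).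
    rewrite /sqnorm -(RintegralZl 2 measurableT i1) -(RintegralZl 2 measurableT i2).
    rewrite -(RintegralD measurableT (integrableZl measurableT 2 i1)
      (integrableZl measurableT 2 i2)).
    apply: le_Rintegral => //.
      exact: (integrable_normsq (mx_sqintD sf (sVW sf))).
    by move=> x _; exact: normsqD.
  have h1 := hc _ sf; have h2 := hd _ (sW sf).
  have h3 := le_trans h2 (ler_wpM2l d0 h1).
  by move: h3; rewrite -/V -/W; lra.
Qed.

End S_operator.

Theorem proposition3p2 (R : realType) (m1 m2 : nat) (l : R)
    (Phi1 dPhi1 : R -> 'M[R[i]]_(m2, m1)) :
  (0 < m1)%N -> (0 < m2)%N -> 0 < l ->
  boundedly_differentiable l Phi1 dPhi1 ->
  let S := S_op l Phi1 dPhi1 in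
  [/\ bounded_operator l S,
      strictly_positive l S &
      op_le l (fun f => f) S].
Proof.
move=> _ _ l0 /cutoff_bmeas bD S; split.
- exact: S_bounded.
- by apply: op_le_id_scale1; exact: S_ge_id.
- exact: S_ge_id.
Qed.
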